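(* Let $(X,d,\mu)$ be an Ahlfors $\gamma$-regular metric measure space ($\gamma>0$), let $\mathcal{D}$ be a dyadic family on $X$ with an associated Haar system $\mathscr{H}$, and let $s>\tfrac{\gamma}{2}$. Let $H^{s/\gamma,0}_{d,\mu}$ denote any one of the spaces $H^{s/\gamma}_{d,\mu}\cap \mathrm{Ker}\,\Pi_\lambda$ ($\lambda>0$) or $H^{s/\gamma}_{d,\mu}\cap \mathrm{Ker}\,P_j$ ($j\in\mathbb{Z}$). Then there exists a function $\mathcal{G}(x,y)$ defined on $X\times X$ such that for each $x\in X$ the function $\mathcal{G}(x,\cdot)$ belongs to $H^{s/\gamma,0}_{d,\mu}$ and satisfies $$B^{d,\mu}_{s/\gamma}(\mathcal{G}(x,\cdot),v)=v(x)\qquad\text{for every } v\in H^{s/\gamma,0}_{d,\mu},$$ where $v(x)$ denotes the value at $x$ of the continuous representative of $v$.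
   Context: All functions are real valued. A metric space $(X,d)$ with a Borel measure $\mu$ is Ahlfors $\gamma$-regular if there are constants $c_1,c_2>0$ with $c_1r^\gamma\le\mu(B(x,r))\le c_2r^\gamma$ for all $x\in X$ and $r>0$, where $B(x,r)=\{y\in X:d(x,y)<r\}$. (Such a space is unbounded, without atoms, with $\mu(X)=+\infty$.) Dyadic family: $\mathcal{D}=\bigcup_{j\in\mathbb{Z}}\mathcal{D}_j$ is a family of subsets of $X$ (called cubes) such that: there are $0<\nu<1$ and positive constants $a_1,a_2,a_3$ such that every $Q\in\mathcal{D}_j$ satisfies $a_1\nu^j\le \mathrm{diam}\,Q\le a_2\nu^j$ and there are $d$-balls $B_1\subseteq Q\subseteq B_2$ whose radii satisfy $r(B_1)\ge a_3\, r(B_2)$; each cube is a Borel set; each $\mathcal{D}_j$ is a partition of $X$; for each $Q\in\mathcal{D}_{j+1}$ there is exactly one $\widetilde Q\in\mathcal{D}_j$ with $Q\subseteq\widetilde Q$; there is a constant $M$ with $1\le\#\vartheta(Q)\le M$ for every $Q\in\mathcal{D}_j$, where $\vartheta(Q)=\{Q'\in\mathcal{D}_{j+1}:Q'\subseteq Q\}$; any two cubes are disjoint or one contains the other; for every $Q\in\mathcal{D}$ the union of all cubes of $\mathcal{D}$ containing $Q$ is $X$. Haar system: for $Q\in\mathcal{D}$ with $\#\vartheta(Q)>1$, $\mathscr{H}(Q)=\{h_l:l=1,\dots,\#\vartheta(Q)-1\}$ is such that $\{\mu(Q)^{-1/2}\mathcal{X}_Q\}\cup\mathscr{H}(Q)$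 is an orthonormal basis (in $L^2(X,\mu)$) of the space of functions vanishing outside $Q$ and constant on each $Q'\in\vartheta(Q)$; $\mathscr{H}=\bigcup_{Q}\mathscr{H}(Q)$, which is an orthonormal basis of $L^2(X,\mu)$. For $h\in\mathscr{H}(Q)$ write $Q(h)=Q$. Projections: $\Pi_\lambda$ is the orthogonal projection of $L^2(X,\mu)$ onto the closed linear span of $\{h\in\mathscr{H}:\mu(Q(h))>\lambda\}$; $P_j$ is the orthogonal projection of $L^2(X,\mu)$ onto $V_j=\{f\in L^2(X,\mu): f \text{ is constant on each } Q\in\mathcal{D}_j\}$. Energy: for $\sigma>0$, $\mathscr{E}^{d,\mu}_\sigma(u)=\iint_{X\times X}\frac{|u(x)-u(y)|^2}{\mu(B(x,d(x,y)))^{1+2\sigma}}\,d\mu(x)d\mu(y)$ and $H^\sigma_{d,\mu}=\{u\in L^2(X,\mu):\mathscr{E}^{d,\mu}_\sigma(u)<\infty\}$ with norm $\|u\|_{L^2}+\sqrt{\mathscr{E}^{d,\mu}_\sigma(u)}$. The bilinear form is $$B^{d,\mu}_{s/\gamma}(u,v)=\int_X\int_X\frac{u(x)-u(y)}{d^s(x,y)}\,\frac{v(x)-v(y)}{d^s(x,y)}\,\frac{d\mu(x)d\mu(y)}{d^\gamma(x,y)}.$$ For $s>\gamma/2$, elements of $H^{s/\gamma}_{d,\mu}$ (classes modulo $\mu$-a.e. equality) are identified with their continuous representatives. *)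

(* Defs.v *)
From HB Require Import structures.
From mathcomp Require Import all_boot all_order all_algebra.
From mathcomp Require Import all_classical all_reals all_analysis.

Set Implicit Arguments.
Unset Strict Implicit.
Unset Printing Implicit Defensive.

Import Order.TTheory GRing.Theory Num.Theory.
Import numFieldNormedType.Exports.

Local Open Scope classical_set_scope.
Local Open Scope ring_scope.

(* Metric and sigma-algebra on one carrier (a measurableType is pointed, so X
   is nonempty). The compatibility of the two is the separate [is_borel]. *)
#[short(type="metricMeasurableType")]
HB.structure Definition MetricMeasurable (d : measure_display)
    (R : numDomainType) := {T of Metric R T & Measurable d T}.

Section setting.
Context {R : realType} {d : measure_display} {X : metricMeasurableType d R}.

Definition is_borel : Prop := @measurable d X = <<s (@open X) >>.

Variable mu : {measure set X -> \bar R}.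

(* [ball x r] is {y | mdist x y < r} (lemma ballEmdist). *)
Definition ahlfors_regular (gamma : R) : Prop :=
  exists c1 c2 : R, [/\ 0 < c1, 0 < c2 & forall (x : X) (r : R), 0 < r ->
    ((c1 * r `^ gamma)%:E <= mu (ball x r) <= (c2 * r `^ gamma)%:E)%E].

Definition diam (Q : set X) : \bar R :=
  ereal_sup [set (mdist p.1 p.2)%:E | p in Q `*` Q].

Implicit Types (D : int -> set (set X)) (Q : set X) (j : int).

(* A set Q may be a cube of several consecutive generations, so the children
   of Q are taken relative to the generation j at which Q is considered. *)
Definition children D j Q : set (set X) :=
  [set Q' | D (j + 1) Q' /\ Q' `<=` Q].

Definition is_cube_of D Q : Prop := exists j, D j Q.

Record dyadic_family D : Prop := {
  dyadic_size : exists nu a1 a2 a3 : R,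
    [/\ 0 < nu < 1, 0 < a1, 0 < a2, 0 < a3 &
      forall j Q, D j Q ->
        ((a1 * nu ^ j)%:E <= diam Q <= (a2 * nu ^ j)%:E)%E /\
        exists (x1 x2 : X) (r1 r2 : R),
          [/\ 0 < r1, 0 < r2, ball x1 r1 `<=` Q, Q `<=` ball x2 r2 &
              a3 * r2 <= r1]];
  dyadic_measurable : forall j Q, D j Q -> measurable Q;
  dyadic_partition : forall j, partition (D j) id [set: X];
  dyadic_parent : forall j Q, D (j + 1) Q ->
    exists! Q', D j Q' /\ Q `<=` Q';
  dyadic_children : exists M : nat, forall j Q, D j Q ->
    exists n : nat, (1 <= n <= M)%N /\ (children D j Q #= `I_n)%card;
  dyadic_nested : forall Q Q', is_cube_of D Q -> is_cube_of D Q' ->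
    [\/ Q `&` Q' = set0, Q `<=` Q' | Q' `<=` Q];
  dyadic_exhaust : forall Q, is_cube_of D Q ->
    \bigcup_(Q' in [set Q' | is_cube_of D Q' /\ Q `<=` Q']) Q' = [set: X] }.

(* Elements of L^2 are represented by functions X -> R; all notions below are
   invariant under mu-a.e. equality unless they are explicitly pointwise. *)
Definition L2 : set (X -> R) := [set f | f \in Lfun mu 2%:E].

Definition L2dot (f g : X -> R) : R := (\int[mu]_x (f x * g x))%R.

Definition orthonormal_basis (n : nat) (e : 'I_n -> X -> R)
    (W : set (X -> R)) : Prop :=
  [/\ forall i, W (e i),
      forall i k, L2dot (e i) (e k) = (i == k)%:R &
      forall f, W f -> exists c : 'I_n -> R,
        forall x, f x = \sum_(i < n) c i * e i x].

Definition step_functions D j Q : set (X -> R) :=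
  [set f | (forall x, ~ Q x -> f x = 0) /\
           forall Q', children D j Q Q' -> exists c, forall x, Q' x -> f x = c].

(* h Q l, for l < #children - 1, are the Haar functions of Q. Indexing by the
   set Q alone is harmless: if Q is a cube of several generations, only the
   last of them has more than one child. *)
Definition haar_system D (h : set X -> nat -> X -> R) : Prop :=
  forall j Q (n : nat), D j Q -> (children D j Q #= `I_n)%card -> (1 < n)%N ->
    orthonormal_basis
      (fun i : 'I_n => if (i : nat) is l.+1 then h Q l
                       else fun x => (Num.sqrt (fine (mu Q)))^-1 * \1_Q x)
      (step_functions D j Q).

Definition haar_above D (h : set X -> nat -> X -> R) (lambda : R) :
    set (X -> R) :=
  [set f | exists j Q (n l : nat),
     [/\ D j Q, (children D j Q #= `I_n)%card, (l < n.-1)%N,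
         (lambda%:E < mu Q)%E & f = h Q l]].

Definition linear_span (S : set (X -> R)) : set (X -> R) :=
  [set f | exists (n : nat) (c : 'I_n -> R) (g : 'I_n -> X -> R),
     (forall i, S (g i)) /\ f = fun x => \sum_(i < n) c i * g i x].

Definition closed_span (S : set (X -> R)) : set (X -> R) :=
  [set f | L2 f /\ forall e : R, 0 < e -> exists2 g, linear_span S g &
     ('N[mu]_2%:E [EFin \o (f \- g)%R] < e%:E)%E].

Definition dyadic_space D j : set (X -> R) :=
  [set f | L2 f /\ forall Q, D j Q -> exists c : R,
     \forall x \ae mu, Q x -> f x = c].

(* g is the orthogonal projection of f onto the closed subspace V *)
Definition is_orthogonal_projection (V : set (X -> R)) (f g : X -> R) : Prop :=
  V g /\ forall v, V v -> L2dot (f \- g) v = 0.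

Definition ker_projection (V : set (X -> R)) : set (X -> R) :=
  [set f | L2 f /\ is_orthogonal_projection V f (fun=> 0)].

Definition ker_Pi D h (lambda : R) : set (X -> R) :=
  ker_projection (closed_span (haar_above D h lambda)).

Definition ker_P D j : set (X -> R) := ker_projection (dyadic_space D j).

(* Double integrals are iterated. On the diagonal the quotients below are
   0 / 0, which is 0 here; the diagonal is (mu x mu)-null. *)
Definition energy (sigma : R) (u : X -> R) : \bar R :=
  (\int[mu]_y \int[mu]_x
     (`|u x - u y| ^+ 2 /
        fine (mu (ball x (mdist x y))) `^ (1 + 2 * sigma))%:E)%E.

Definition sobolev (sigma : R) : set (X -> R) :=
  [set u | L2 u /\ (energy sigma u < +oo)%E].

Definition bilinear_form (gamma s : R) (u v : X -> R) : \bar R :=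
  (\int[mu]_y \int[mu]_x
     ((u x - u y) / mdist x y `^ s * ((v x - v y) / mdist x y `^ s)
        / mdist x y `^ gamma)%:E)%E.

Definition is_sobolev0 D h (sigma : R) (H0 : set (X -> R)) : Prop :=
  (exists2 lambda : R, 0 < lambda &
     H0 = sobolev sigma `&` ker_Pi D h lambda) \/
  (exists j, H0 = sobolev sigma `&` ker_P D j).

Definition continuous_representative (v w : X -> R) : Prop :=
  continuous w /\ v = w %[ae mu].

End setting.

Arguments is_borel {R d} X.

(* Main.v *)
Require Import Defs.
From HB Require Import structures.
From mathcomp Require Import all_boot all_order all_algebra.
From mathcomp Require Import all_classical all_reals all_analysis.
From mathcomp Require Import measurable_realfun ring lra zify.
Import Order.TTheory GRing.Theory Num.Theory.
Import numFieldNormedType.Exports.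
Local Open Scope classical_set_scope.
Local Open Scope ring_scope.

Set Implicit Arguments.
Unset Strict Implicit.
Unset Printing Implicit Defensive.

(* The function G(x, .) is the Riesz representer of the evaluation at x in the
   space H0 with the inner product B. By Ahlfors regularity the energy of u is
   comparable to B(u, u), and B(u, v) is the L^2(mu x mu) inner product of the
   quotients (u(x) - u(y)) / d(x, y)^(s + gamma / 2). Jensen's inequality bounds
   the difference of the averages of v over two balls of radius r at distance at
   most r by C r^(s - gamma / 2) B(v, v)^(1/2). As s > gamma / 2, the averages
   over the balls of radius 2^-k converge to a continuous function, which equals
   v wherever the inner integral of the energy is finite, hence almost
   everywhere. Membership in the kernel of a projection makes the averages of v
   vanish over all cubes of some generation j: for P_j because indicators of
   cubes are in V_j; for Pi_lambda because v has the same average over a large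
   cube and over its parent, and these averages tend to 0 along the ancestors.
   The same estimates, applied to these cubes, then bound the sup norm and the
   L^2 norm of v by B(v, v)^(1/2). *)

(** * Hilbert space preliminaries *)

Section real_lemmas.
Context {R : realType}.
Implicit Types a b c e p q t : R.

(** The value at the minimiser [- b / a] is [c - b ^+ 2 / a]; when [a = 0], an affine function that
    stays nonnegative has slope zero. *)
Lemma discriminant_le a b c : 0 <= a ->
  (forall t, 0 <= a * t ^+ 2 + 2 * b * t + c) -> b ^+ 2 <= a * c.
Proof.
move=> a0 H.
have [a_gt0|] := ltP 0 a; last first.
  move=> ?; have aE : a = 0 by lra.
  rewrite aE in H *.
  rewrite mul0r; have [->|b0] := eqVneq b 0; first by rewrite expr0n.
  (* At this point the affine function would take the value -1. *)
  have := H (- (c + 1) / (2 * b)); rewrite mul0r add0r.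
  have -> : 2 * b * (- (c + 1) / (2 * b)) = - (c + 1) by field.
  lra.
have := H (- b / a).
have -> : a * (- b / a) ^+ 2 + 2 * b * (- b / a) + c = (a * c - b ^+ 2) / a.
  by field; rewrite gt_eqF.
by rewrite pmulr_lge0 ?invr_gt0// subr_ge0.
Qed.

Lemma sqr_le_small_eq0 p a : (forall e, 0 < e -> p ^+ 2 <= a * e) -> p = 0.
Proof.
move=> H; apply/eqP; rewrite -sqrf_eq0 eq_le sqr_ge0 andbT.
apply/ler_addgt0Pl => e e0; rewrite addr0.
have n0 : 0 < `|a| + 1 by rewrite ltr_wpDl.
have e'0 : 0 < e / (`|a| + 1) by rewrite divr_gt0.
apply: (le_trans (H _ e'0)).
rewrite mulrCA ler_piMr ?(ltW e0)// ler_pdivrMr// mul1r.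
by have := ler_norm a; lra.
Qed.

Lemma geometric_small a q e : 0 < q < 1 -> 0 < e ->
  exists n : nat, a * q ^+ n < e.
Proof.
move=> /andP[q0 q1] e0.
have : (fun n => a * q ^+ n) @ \oo --> (0 : R).
  rewrite -[X in _ --> X](mulr0 a); apply: cvgMr.
  by apply: cvg_expr; rewrite ger0_norm// ltW.
move=> /cvgrPdist_lt/(_ e e0)[N _ HN]; exists N.
have := HN N (leqnn _); rewrite /= sub0r normrN; apply: le_lt_trans.
exact: ler_norm.
Qed.

End real_lemmas.

Section riesz.
Context {R : realType} {V : lmodType R} (H : set V) (b : V -> V -> R).
Hypothesis H0 : H 0.
Hypothesis HD : forall u v, H u -> H v -> H (u + v).
Hypothesis HZ : forall (a : R) u, H u -> H (a *: u).
Hypothesis bC : forall u v, H u -> H v -> b u v = b v u.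
Hypothesis bD : forall u v w, H u -> H v -> H w -> b (u + v) w = b u w + b v w.
Hypothesis bZ : forall (a : R) u w, H u -> H w -> b (a *: u) w = a * b u w.
Hypothesis b0 : forall u, H u -> 0 <= b u u.
Hypothesis bcomplete : forall v : nat -> V, (forall n, H (v n)) ->
  (forall e : R, 0 < e -> exists N : nat, forall m n,
     (N <= m)%N -> (N <= n)%N ->
     b (v m - v n) (v m - v n) <= e) ->
  exists2 g, H g & forall e : R, 0 < e ->
     exists N : nat, forall n, (N <= n)%N ->
     b (v n - g) (v n - g) <= e.

Let HN u : H u -> H (- u). Proof. by rewrite -scaleN1r; exact: HZ. Qed.
Let HB u v : H u -> H v -> H (u - v).
Proof. by move=> hu hv; apply: HD => //; exact: HN. Qed.

Let bDr u v w : H u -> H v -> H w -> b w (u + v) = b w u + b w v.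
Proof. by move=> *; rewrite bC ?bD ?(bC (v := w))//; exact: HD. Qed.
Let bZr (a : R) u w : H u -> H w -> b w (a *: u) = a * b w u.
Proof. by move=> *; rewrite bC ?bZ ?(bC (v := w))//; exact: HZ. Qed.

Let qD u v : H u -> H v -> b (u + v) (u + v) = b u u + 2 * b u v + b v v.
Proof.
move=> hu hv; rewrite bD ?bDr//; last exact: HD.
by rewrite (bC hv hu); ring.
Qed.

Let qDZ t u v : H u -> H v ->
  b (u + t *: v) (u + t *: v) = b u u + 2 * t * b u v + t ^+ 2 * b v v.
Proof.
move=> hu hv; rewrite qD//; last exact: HZ.
rewrite (bZ t hv (HZ t hv)) (bZr t hv hv) (bZr t hv hu); ring.
Qed.

Lemma form_cauchy_schwarz u v : H u -> H v -> b u v ^+ 2 <= b v v * b u u.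
Proof.
move=> hu hv; apply: discriminant_le; first exact: b0.
move=> t; have := b0 (HD hu (HZ t hv)).
by rewrite qDZ//; lra.
Qed.

(* The representer is the minimiser of [J v = b v v - 2 L v]; by the
   parallelogram law every minimising sequence is Cauchy. *)
Lemma riesz_representation (L : V -> R) (C : R) :
  (forall u v, H u -> H v -> L (u + v) = L u + L v) ->
  (forall a u, H u -> L (a *: u) = a * L u) ->
  (forall u, H u -> L u ^+ 2 <= C * b u u) ->
  exists2 g, H g & forall v, H v -> b g v = L v.
Proof.
move=> LD LZ Lb.
pose J v := b v v - 2 * L v.
(* By AM-GM, [2 * L v] is at most [b v v] plus the absolute value of [C]; the absolute value covers
   a negative [C]. *)
have JlbE v : H v -> - `|C| <= J v.
  move=> hv; have Hv := Lb _ hv; have bv := b0 hv.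
  have {Hv} : L v ^+ 2 <= `|C| * b v v.
    by apply: (le_trans Hv); rewrite ler_wpM2r// ler_norm.
  have := normr_ge0 C; rewrite /J.
  move: (`|C|) (b v v) (L v) bv => c p l p0 lcp c0.
  rewrite leNgt; apply/negP => h.
  have : 0 < (2 * l - (p + c)) * (2 * l + (p + c)) by apply: mulr_gt0; lra.
  by have := sqr_ge0 (p - c); nra.
have infJ : has_inf (J @` H).
  split; first by exists (J 0), 0.
  by exists (- `|C|) => _ [v hv <-]; exact: JlbE.
set m := inf (J @` H).
have mJ v : H v -> m <= J v.
  by move=> hv; apply: ge_inf; [case: infJ|exists v].
have /choice[v_ v_P] : forall n : nat, exists v, H v /\ J v < m + n.+1%:R^-1.
  move=> n; have n0 : 0 < n.+1%:R^-1 :> R by rewrite invr_gt0.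
  by have [_ [v hv <-] ?] := inf_adherent n0 infJ; exists v.
have Hv n : H (v_ n) by case: (v_P n).
have invn0 n : 0 <= n.+1%:R^-1 :> R by [].
have vN (e : R) : 0 < e ->
    exists N : nat, forall n, (N <= n)%N -> n.+1%:R^-1 <= e :> R.
  move=> e0; have [N _ hN] := near_infty_natSinv_lt (PosNum e0).
  by exists N => n Nn; apply/ltW/hN.
have cauchy (e : R) : 0 < e -> exists N : nat, forall p q,
     (N <= p)%N -> (N <= q)%N ->
     b (v_ p - v_ q) (v_ p - v_ q) <= e.
  move=> e0; have [|N hN] := vN (e / 4); first by lra.
  exists N => p q /hN Np /hN Nq.
  (* Since [J] is at least [m] at the midpoint, the parallelogram law bounds the form at
     [v_ p - v_ q] by twice the sum of the two excesses of [J] over [m], each at most [e / 4]. *)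
  have hmid : H (2^-1 *: (v_ p + v_ q)) by exact/HZ/HD.
  have Jm := mJ _ hmid.
  rewrite /J (bZ _ (HD (Hv p) (Hv q)) hmid) bZr ?LZ ?LD ?qD// in Jm;
    try exact: HD.
  have [_] := v_P p; have [_] := v_P q; rewrite /J => Jq Jp.
  rewrite -(scaleN1r (v_ q)).
  rewrite qDZ//; move: Jm Jp Jq Np Nq.
  by move: (p.+1%:R^-1) (q.+1%:R^-1) => ? ?; lra.
have [g Hg gv] := bcomplete Hv cauchy.
exists g => // v hv; apply/eqP; rewrite -subr_eq0; apply/eqP.
(* The error splits into [b (v_ n) v - L v] and [b (v_ n - g) v], both with square at most
   [b v v * e]; squaring the sum gives the factor 4. *)
apply: (@sqr_le_small_eq0 _ _ (4 * b v v)) => e e0.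
have [N1 hN1] := vN _ e0; have [N2 hN2] := gv _ e0.
pose n := maxn N1 N2.
(* As [v_ n] minimises [J] up to [e], the quadratic [t ^+ 2 * b v v + 2 * t * (b (v_ n) v - L v) +
   e] is nonnegative for every [t]. *)
have nv : (b (v_ n) v - L v) ^+ 2 <= b v v * e.
  apply: discriminant_le; first exact: b0.
  move=> t; have := mJ _ (HD (Hv n) (HZ t hv)).
  have [_] := v_P n; have := hN1 n (leq_maxl _ _).
  rewrite /J qDZ// LD ?LZ//; last exact: HZ.
  by move: (n.+1%:R^-1) => ?; lra.
have ng : b (v_ n - g) v ^+ 2 <= b v v * e.
  apply: (le_trans (form_cauchy_schwarz (HB (Hv n) Hg) hv)).
  by rewrite ler_wpM2l ?b0// hN2// leq_maxr.
move: ng; rewrite -scaleN1r bD ?bZ//; last exact: HZ.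
move: nv (sqr_ge0 (b (v_ n) v - L v + (b (v_ n) v - b g v))).
move: (b (v_ n) v) (b g v) (L v) (b v v) => p q l c; nra.
Qed.

End riesz.

(** * Integrals of nonnegative functions *)

Section nonneg_integral.
Context d (T : measurableType d) (R : realType).
Variable m : {measure set T -> \bar R}.

(* No measurability is assumed, unlike in [ge0_le_integral]. *)
Lemma nonneg_le_integral (f g : T -> \bar R) :
  (forall x, 0 <= f x)%E -> (forall x, f x <= g x)%E ->
  (\int[m]_x f x <= \int[m]_x g x)%E.
Proof.
move=> f0 fg; have g0 x : (0 <= g x)%E by exact: le_trans (f0 x) (fg x).
rewrite !ge0_integralTE//; apply: le_ereal_sup => _ [h hf <-].
by exists h => // x; exact: le_trans (hf x) (fg x).
Qed.

Lemma fatou_bounded (f : nat -> T -> R) (g : T -> R) (c : \bar R) (N : nat) :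
  (forall n, measurable_fun setT (f n)) -> (forall n x, 0 <= f n x) ->
  (forall x, f n x @[n --> \oo] --> g x) ->
  (forall n, (N <= n)%N -> \int[m]_x (f n x)%:E <= c)%E ->
  (\int[m]_x (g x)%:E <= c)%E.
Proof.
move=> mf f0 fg fc.
have -> : (\int[m]_x (g x)%:E = \int[m]_x limn_einf (fun n => (f n x)%:E))%E.
  apply: eq_integral => x _; suff /cvg_limn_einf_sup[-> _] :
    (f n x)%:E @[n --> \oo] --> (g x)%:E by [].
  by apply: cvg_EFin; [exact: nearW|exact: fg].
apply: (le_trans (fatou _ _ _ _)) => //.
- by move=> n; exact/measurable_EFinP.
- by move=> n x _; rewrite lee_fin.
rewrite limn_einf_lim; apply: lime_le; first exact: is_cvg_einfs.
(* The index [maxn n N] lies both in the tail whose infimum is taken and in the range where the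
   bound [c] holds. *)
near=> n; apply: le_trans (fc (maxn n N) (leq_maxr _ _)).
by apply: ereal_inf_lbound; exists (maxn n N) => //=; rewrite leq_maxl.
Unshelve. all: by end_near. Qed.

End nonneg_integral.

(** * Square integrable functions and their inner product *)

Section square_integrable.
Context d (T : measurableType d) (R : realType).
Variable m : {measure set T -> \bar R}.
Implicit Types f g h : T -> R.

(** Square integrability of genuine functions, not of classes, so that the Hilbert space lemmas
    apply inside the module [T -> R]; it is used for [mu] and for the product measure alike. *)
Definition sqint f : Prop :=
  measurable_fun setT f /\ (\int[m]_x (f x ^+ 2)%:E < +oo)%E.

Definition dot f g : R := (\int[m]_x (f x * g x))%R.

Lemma Lfun2P f : f \in Lfun m 2%:E <-> sqint f.
Proof.
split=> [f2|[mf f2]].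
  have := Lfun2_integrable_sqr f2 => /integrableP[_].
  move: f2; rewrite inE => /andP[/[!inE]/= mf _] f2; split=> //.
  apply: le_lt_trans f2; apply: nonneg_le_integral => x.
    by rewrite lee_fin sqr_ge0.
  by rewrite /= lee_fin ler_norm.
rewrite inE; apply/andP; split; rewrite inE//=.
rewrite /finite_norm unlock; apply: poweR_lty.
apply: le_lt_trans f2; apply: nonneg_le_integral => x.
  exact: poweR_ge0.
by rewrite /= lee_fin powR_mulrn// real_normK ?num_real.
Qed.

Lemma sqint_le f g : measurable_fun setT f -> sqint g ->
  (forall x, f x ^+ 2 <= g x ^+ 2) -> sqint f.
Proof.
move=> mf [mg g2] fg; split=> //; apply: le_lt_trans g2.
by apply: nonneg_le_integral => x; rewrite lee_fin ?sqr_ge0.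
Qed.

Lemma integrable_sqr f : sqint f -> m.-integrable setT (fun x => (f x ^+ 2)%:E).
Proof.
move=> [mf f2]; apply/integrableP; split.
  by apply/measurable_EFinP; exact: measurable_funX.
by under eq_integral do rewrite gee0_abs ?lee_fin ?sqr_ge0//.
Qed.

Lemma sqint0 : sqint 0.
Proof.
split; first exact: measurable_cst.
by under eq_integral do rewrite /= expr0n/=; rewrite integral0.
Qed.

Lemma integrable_dot f g : sqint f -> sqint g ->
  m.-integrable setT (EFin \o (fun x => f x * g x)).
Proof.
move=> sf sg; have [mf _] := sf; have [mg _] := sg.
have := integrableD measurableT (integrable_sqr sf) (integrable_sqr sg).
apply: le_integrable => //.
  by apply/measurable_EFinP; exact: measurable_funM.
move=> x _ /=; rewrite lee_fin [leRHS]ger0_norm ?addr_ge0 ?sqr_ge0//.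
by rewrite ler_norml; apply/andP; split; nra.
Qed.

Lemma sqintZ (a : R) f : sqint f -> sqint (a *: f).
Proof.
move=> sf; have [mf f2] := sf; split; first exact: measurable_funM.
under eq_integral do rewrite /= exprMn EFinM.
rewrite ge0_integralZl//.
- by rewrite lte_mul_pinfty// lee_fin sqr_ge0.
- by apply/measurable_EFinP; exact: measurable_funX.
- by move=> x _; rewrite lee_fin sqr_ge0.
- by rewrite lee_fin sqr_ge0.
Qed.

Lemma sqintD f g : sqint f -> sqint g -> sqint (f + g).
Proof.
move=> sf sg; have [mf f2] := sf; have [mg g2] := sg.
split; first exact: measurable_funD.
have := integrableD measurableT (integrable_sqr (sqintZ 2 sf))
  (integrable_sqr (sqintZ 2 sg)).
move=> /integrableP[_]; apply: le_lt_trans; apply: nonneg_le_integral => x.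
  by rewrite lee_fin sqr_ge0.
rewrite /= lee_fin; apply: le_trans (ler_norm _).
rewrite /= !fctE /=; move: (f x) (g x) => p q.
by have := sqr_ge0 (p - q); rewrite /GRing.scale/=; nra.
Qed.

Lemma sqintN f : sqint f -> sqint (- f).
Proof. by rewrite -scaleN1r; exact: sqintZ. Qed.

Lemma sqintB f g : sqint f -> sqint g -> sqint (f - g).
Proof. by move=> sf sg; apply: sqintD => //; exact: sqintN. Qed.

Lemma dotC f g : dot f g = dot g f.
Proof. by apply: eq_Rintegral => x _; rewrite mulrC. Qed.

Lemma dotDl f g h : sqint f -> sqint g -> sqint h ->
  dot (f + g) h = dot f h + dot g h.
Proof.
move=> sf sg sh; rewrite /dot -RintegralD//; try exact: integrable_dot.
by apply: eq_Rintegral => x _; rewrite /= mulrDl.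
Qed.

Lemma dotZl (a : R) f g : sqint f -> sqint g -> dot (a *: f) g = a * dot f g.
Proof.
move=> sf sg; rewrite /dot -RintegralZl//; last exact: integrable_dot.
by apply: eq_Rintegral => x _; rewrite /= -mulrA.
Qed.

Lemma dot_ge0 f : 0 <= dot f f.
Proof. by apply: Rintegral_ge0 => x _; rewrite -expr2 sqr_ge0. Qed.

Lemma EFin_dot f : sqint f -> (dot f f)%:E = (\int[m]_x (f x ^+ 2)%:E)%E.
Proof.
move=> sf; have [mf f2] := sf.
rewrite /dot /Rintegral fineK.
  by apply: eq_integral => x _; rewrite expr2.
exact: (integrable_fin_num measurableT (integrable_dot sf sf)).
Qed.

Lemma dot_cauchy_schwarz f g : sqint f -> sqint g ->
  dot f g ^+ 2 <= dot g g * dot f f.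
Proof.
move=> sf sg; apply: (@form_cauchy_schwarz R (T -> R) sqint) => //.
- exact: sqintD.
- exact: sqintZ.
- by move=> *; exact: dotC.
- exact: dotDl.
- exact: dotZl.
- by move=> *; exact: dot_ge0.
Qed.

Lemma sqint_indic A : measurable A -> (m A < +oo)%E -> sqint \1_A.
Proof.
move=> mA Aoo; split; first exact: measurable_indic.
rewrite (_ : (\int[m]_x _)%E = m A)//.
have := integral_indic m measurableT mA; rewrite setIT => <-.
apply: eq_integral => x _.
by rewrite indicE; case: (x \in A); rewrite ?expr1n ?expr0n.
Qed.

Lemma sqint_ae f g : measurable_fun setT g -> f = g %[ae m] -> sqint f ->
  sqint g.
Proof.
move=> mg fg [mf f2]; split=> //; apply: le_lt_trans f2.
rewrite le_eqVlt; apply/orP; left; apply/eqP; apply: ae_eq_integral => //.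
- by apply/measurable_EFinP; exact: measurable_funX.
- by apply/measurable_EFinP; exact: measurable_funX.
- by move: fg; apply: filterS => x /= /(_ I) ->.
Qed.

Lemma dot_ae f g h : f = g %[ae m] -> measurable_fun setT f ->
  measurable_fun setT g -> measurable_fun setT h -> dot f h = dot g h.
Proof.
move=> fg mf mg mh; congr fine; apply: ae_eq_integral => //.
- by apply/measurable_EFinP; exact: measurable_funM.
- by apply/measurable_EFinP; exact: measurable_funM.
- by move: fg; apply: filterS => x /= /(_ I) ->.
Qed.

End square_integrable.

(** * Averages over sets of finite positive measure *)

Section averages.
Context d (T : measurableType d) (R : realType).
Variable m : {measure set T -> \bar R}.
Implicit Types f : T -> R.

Lemma sqint_dot_sum (I : Type) (r : seq I) (c : I -> R) (e : I -> T -> R) f :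
  sqint m f -> (forall i, sqint m (e i)) ->
  sqint m (\sum_(i <- r) c i *: e i) /\
  dot m (\sum_(i <- r) c i *: e i) f = \sum_(i <- r) c i * dot m (e i) f.
Proof.
move=> sf se; elim: r => [|i r [IH1 IH2]].
  rewrite !big_nil; split; first exact: sqint0.
  by have := dotZl 0 sf sf; rewrite scale0r mul0r.
rewrite !big_cons; split; first by apply: sqintD => //; exact: sqintZ.
by rewrite dotDl ?dotZl ?IH2//; exact: sqintZ.
Qed.

Lemma dot_indic (A : set T) : measurable A -> (m A < +oo)%E ->
  dot m \1_A \1_A = fine (m A).
Proof.
move=> mA Aoo; apply: EFin_inj; rewrite EFin_dot; last exact: sqint_indic.
rewrite fineK ?ge0_fin_numE//.
have := integral_indic m measurableT mA; rewrite setIT => <-.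
apply: eq_integral => x _; rewrite indicE.
by case: (x \in A); rewrite ?expr1n ?expr0n.
Qed.

Definition avg (A : set T) f : R := dot m f \1_A / fine (m A).

(** This is Cauchy-Schwarz for [(c - v) * \1_A] against [\1_A], whose inner product is
    [fine (m A) * (c - avg A v)]. *)
Lemma avg_jensen (v : T -> R) (A : set T) (c : R) : sqint m v -> measurable A ->
  (0 < m A < +oo)%E ->
  ((fine (m A) * (c - avg A v) ^+ 2)%:E <=
   \int[m]_x (((c - v x) * \1_A x) ^+ 2)%:E)%E.
Proof.
move=> sv mA /andP[A0 Aoo].
have [mv v2] := sv.
have s1 : sqint m \1_A by exact: sqint_indic.
have mAE : (fine (m A))%:E = m A by rewrite fineK// ge0_fin_numE.
have a0 : 0 < fine (m A) by rewrite -lte_fin mAE.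
have sqr1 x : \1_A x * \1_A x = \1_A x :> R.
  by rewrite indicE; case: (x \in A); rewrite ?mulr1 ?mulr0.
pose v1 x := v x * \1_A x.
have sv1 : sqint m v1.
  apply: (@sqint_le _ _ _ m _ v) => //.
    by apply: measurable_funM => //; exact: measurable_indic.
  move=> x; rewrite /v1 exprMn expr2 [X in _ * X]expr2 sqr1.
  rewrite indicE; case: (x \in A); rewrite ?mulr1 ?mulr0 ?sqr_ge0//.
pose w := c *: (\1_A : T -> R) - v1.
have sw : sqint m w by apply: sqintB => //; exact: sqintZ.
have -> : (\int[m]_x (((c - v x) * \1_A x) ^+ 2)%:E = (dot m w w)%:E)%E.
  rewrite EFin_dot//; apply: eq_integral => x _; congr (_ ^+ 2)%:E.
  by rewrite /w !fctE /v1 /GRing.scale /=; ring.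
have d11 : dot m \1_A \1_A = fine (m A) by exact: dot_indic.
have dv1 : dot m v1 \1_A = dot m v \1_A.
  by apply: eq_Rintegral => x _; rewrite /v1 -mulrA sqr1.
have dw : dot m w \1_A = c * fine (m A) - dot m v \1_A.
  rewrite /w -scaleN1r dotDl//; try exact: sqintZ.
  by rewrite !dotZl// d11 dv1 mulN1r.
have := dot_cauchy_schwarz sw s1; rewrite d11 dw lee_fin.
have vE : dot m v \1_A = avg A v * fine (m A).
  by rewrite /avg mulfVK// gt_eqF.
rewrite vE => H; rewrite -(ler_pM2l a0); apply: le_trans H.
by rewrite le_eqVlt; apply/orP; left; apply/eqP; ring.
Qed.

(** Cauchy-Schwarz against the indicator; it forces the averages of a fixed [v] to 0 over sets of
    growing measure. *)
Lemma avg_sqr_le (v : T -> R) (A : set T) : sqint m v -> measurable A ->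
  (0 < m A < +oo)%E ->
  avg A v ^+ 2 <= dot m v v / fine (m A).
Proof.
move=> sv mA /andP[A0 Aoo]; have s1 := sqint_indic mA Aoo.
have mAE : (fine (m A))%:E = m A by rewrite fineK// ge0_fin_numE.
have a0 : 0 < fine (m A) by rewrite -lte_fin mAE.
have := dot_cauchy_schwarz sv s1.
rewrite dot_indic//.
move=> H; rewrite /avg expr_div_n ler_pdivrMr ?exprn_gt0//.
by apply: (le_trans H); rewrite expr2 mulrA mulfVK ?gt_eqF// mulrC.
Qed.

End averages.

(** * Geometry of the dyadic cubes *)

Section metric_measurability.
Context {R : realType} {d : measure_display} {X : metricMeasurableType d R}.
Hypothesis borelX : is_borel X.

Lemma measurable_open (A : set X) : open A -> measurable A.
Proof. by rewrite borelX => oA; exact: sub_sigma_algebra. Qed.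

Lemma measurable_continuous (f : X -> R) : continuous f -> measurable_fun setT f.
Proof.
move=> /continuousP cf; apply: (measurability _ (RGenOpens.measurableE R)).
move=> _ [_ [a [b ->] <-]]; rewrite setTI; apply: measurable_open.
exact/cf/interval_open.
Qed.

Lemma metric_dist_le (x y z : X) : `|mdist x y - mdist x z| <= mdist y z.
Proof.
have := metric_triangle x y z; have := metric_triangle x z y.
by rewrite (metric_sym z y) ler_norml; lra.
Qed.

Lemma continuous_mdist (x : X) : continuous (mdist x).
Proof.
move=> y; apply/cvgrPdist_lt => e e0.
have := nbhsx_ballx y e e0; apply: filterS => z.
by rewrite ballEmdist /=; apply: le_lt_trans; exact: metric_dist_le.
Qed.

Lemma measurable_mdist1 (x : X) : measurable_fun setT (mdist x).
Proof. exact/measurable_continuous/continuous_mdist. Qed.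

Lemma measurable_metric_ball (x : X) (r : R) : measurable (ball x r).
Proof.
rewrite ballEmdist.
have := measurable_mdist1 x measurableT (measurable_itv `]-oo, r[).
by rewrite setTI.
Qed.

(** The product sigma-algebra may miss open sets of [X * X], so continuity alone does not suffice. A
    dense sequence writes each sublevel set as a countable union of sets defined by sums of
    one-variable distances. *)
Lemma measurable_mdist (p : nat -> X) :
  (forall x (e : R), 0 < e -> exists n, mdist x (p n) < e) ->
  measurable_fun setT (fun z : X * X => mdist z.1 z.2).
Proof.
move=> p_dense; apply: (measurability _ (RGenInftyO.measurableE R)).
move=> _ [_ [a ->] <-]; rewrite setTI.
rewrite (_ : _ @^-1` _ =
    \bigcup_n [set z : X * X | mdist (p n) z.1 + mdist (p n) z.2 < a]).
  apply: bigcup_measurable => n _.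
  have mn : measurable_fun setT
      (fun z : X * X => mdist (p n) z.1 + mdist (p n) z.2).
    apply: measurable_funD; apply: measurableT_comp => //;
      exact: measurable_mdist1.
  have := mn measurableT _ (measurable_itv `]-oo, a[).
  by rewrite setTI.
apply/seteqP; split => [[x y]|[x y] [n _]] /=; rewrite in_itv /=.
  move=> xya; have [|n xn] := p_dense x ((a - mdist x y) / 2); first by lra.
  exists n => //=; have := metric_triangle (p n) x y.
  by rewrite (metric_sym (p n) x); lra.
by have := metric_triangle x (p n) y; rewrite (metric_sym (p n) x); lra.
Qed.

End metric_measurability.

Section dyadic.
Context {R : realType} {d : measure_display} {X : metricMeasurableType d R}.
Variable D : int -> set (set X).
Hypothesis dyD : dyadic_family D.
Implicit Types (j : int) (Q : set X).

Lemma cube_uniq j Q Q' x : D j Q -> D j Q' -> Q x -> Q' x -> Q = Q'.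
Proof.
have [_ tD _] := dyadic_partition dyD j.
by move=> jQ jQ' Qx Q'x; apply: tD => //; exists x.
Qed.

Lemma cube_at j x : exists2 Q, D j Q & Q x.
Proof.
have [cD _ _] := dyadic_partition dyD j.
by have : cover (D j) id x by rewrite cD.
Qed.

Lemma cube_nonempty j Q : D j Q -> Q !=set0.
Proof. by have [_ _] := dyadic_partition dyD j; exact. Qed.

Lemma cube_ancestor (n : nat) j Q : D (j + n%:Z) Q ->
  exists2 Q', D j Q' & Q `<=` Q'.
Proof.
elim: n j Q => [|n IH] j Q; first by rewrite addr0; exists Q.
rewrite -addn1 PoszD addrA => /(dyadic_parent dyD)[Q1 [[jQ1 QQ1] _]].
have [Q' jQ' Q1Q'] := IH _ _ jQ1.
by exists Q' => //; exact: subset_trans Q1Q'.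
Qed.

Lemma cube_subset (n : nat) j Q Q' x : D j Q -> D (j + n%:Z) Q' ->
  Q x -> Q' x -> Q' `<=` Q.
Proof.
move=> jQ /cube_ancestor[Q1 jQ1 Q'Q1] Qx Q'x.
by rewrite (cube_uniq jQ jQ1 Qx (Q'Q1 _ Q'x)).
Qed.

Lemma finite_children j Q : D j Q -> finite_set (children D j Q).
Proof.
have [M HM] := dyadic_children dyD.
by move=> /HM[n [_ cn]]; rewrite (eq_finite_set cn).
Qed.

Lemma children_cover j Q x : D j Q -> Q x -> exists2 Q', children D j Q Q' & Q' x.
Proof.
move=> jQ Qx; have [Q' jQ' Q'x] := cube_at (j + 1) x.
exists Q' => //; split=> //; exact: (@cube_subset 1 j Q Q' x).
Qed.

Lemma finite_descendants (n : nat) j Q : D j Q ->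
  finite_set [set Q' | D (j + n%:Z) Q' /\ Q' `<=` Q].
Proof.
elim: n => [|n IH] jQ.
  apply: (@sub_finite_set _ _ [set Q]); last exact: finite_set1.
  move=> Q' /= [jQ' Q'Q]; move: jQ'; rewrite addr0 => jQ'.
  have [x Q'x] := cube_nonempty jQ'.
  by apply: (cube_uniq jQ' jQ Q'x); exact: Q'Q.
apply: (@sub_finite_set _ _
    (\bigcup_(Q' in [set Q' | D (j + n%:Z) Q' /\ Q' `<=` Q])
       children D (j + n%:Z) Q')); last first.
  apply: bigcup_finite; first exact: IH.
  by move=> Q' [jQ' _]; exact: finite_children.
move=> Q' /= []; rewrite -addn1 PoszD addrA => jQ' Q'Q.
have [Q1 [[jQ1 Q'Q1] _]] := dyadic_parent dyD jQ'.
exists Q1 => //; split=> //.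
have [x Q'x] := cube_nonempty jQ'.
exact: (cube_subset jQ jQ1 (Q'Q _ Q'x) (Q'Q1 _ Q'x)).
Qed.

(** The ancestors of a fixed cube [Q0] exhaust [X], so every cube of generation [n] descends from
    one of them; there is one ancestor per generation [- k], and each has finitely many descendants
    in generation [n]. *)
Lemma countable_cubes (n : nat) : countable (D n%:Z).
Proof.
have [Q0 D0 _] := cube_at 0 (point : X).
apply: (@sub_countable _ _ _
  (\bigcup_(k in [set: nat]) \bigcup_(A in [set A | D (- k%:Z) A /\ Q0 `<=` A])
     [set Q' | D (- k%:Z + (k + n)%:Z) Q' /\ Q' `<=` A])); last first.
  apply: bigcup_countable => // k _; apply: finite_set_countable.
  apply: bigcup_finite => [|A [kA _]]; last exact: finite_descendants.
  have [x Q0x] := cube_nonempty D0.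
  have [A kA Ax] := cube_at (- k%:Z) x.
  apply: (@sub_finite_set _ _ [set A]); last exact: finite_set1.
  by move=> B /= [kB Q0B]; apply: (cube_uniq kB kA (Q0B _ Q0x) Ax).
apply: subset_card_le => Q nQ; have [x Qx] := cube_nonempty nQ.
have [k [A [kA Q0A Ax]]] : exists k : nat, exists A,
    [/\ D (- k%:Z) A, Q0 `<=` A & A x].
  have : [set: X] x by [].
  rewrite -(dyadic_exhaust dyD (Q := Q0)); last by exists 0.
  move=> [A [[i iA] Q0A] Ax].
  (* A cube of positive generation that contains [Q0] is also contained in it, so [Q0] itself
     serves, with [k = 0]. *)
  have [i0|i0] := lerP i 0.
    exists `|i|%N, A; split=> //; congr (D _ A) : iA.
    by rewrite abszE ler0_norm// opprK.
  exists 0%N, Q0; split=> //; rewrite ?oppr0//.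
  have [y Q0y] := cube_nonempty D0.
  have iE : i = 0 + `|i|%N%:Z by rewrite add0r gez0_abs// ltW.
  rewrite iE in iA.
  exact: (cube_subset D0 iA Q0y (Q0A _ Q0y)).
exists k => //; exists A => //; have nkE : n%:Z = - k%:Z + (k + n)%:Z.
  by rewrite PoszD addrA addNr add0r.
rewrite nkE in nQ; split=> //.
exact: (cube_subset kA nQ Ax Qx).
Qed.

Lemma diam_mdist Q c x y : (diam Q <= c%:E)%E -> Q x -> Q y -> mdist x y <= c.
Proof.
move=> Qc Qx Qy; rewrite -lee_fin; apply: le_trans Qc.
by apply: ereal_sup_ubound; exists (x, y).
Qed.

(** One point is chosen in each cube of nonnegative generation; the diameters of these cubes are at
    most [a2 * nu ^ n], which tends to 0. *)
Lemma dense_sequence :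
  exists p : nat -> X, forall x (e : R), 0 < e -> exists n, mdist x (p n) < e.
Proof.
have [nu [a1 [a2 [a3 [/andP[nu0 nu1] a10 a20 a30 Dsize]]]]] := dyadic_size dyD.
have cU : countable (\bigcup_(n in [set: nat]) D n%:Z).
  by apply: bigcup_countable => // n _; exact: countable_cubes.
have [f f_surj] := elimT pcard_surjP cU.
(* The default [point] is taken only where [f n] is empty, hence never at a cube. *)
exists (fun n => xget point (f n)) => x e e0.
have [|n ne] := @geometric_small _ a2 nu e _ e0; first exact/andP.
have [Q nQ Qx] := cube_at n%:Z x.
have [|k _ fk] := f_surj Q; first by exists n.
exists k; rewrite fk; apply: le_lt_trans ne.
have [/andP[_ Qd] _] := Dsize _ _ nQ.
apply: (diam_mdist Qd Qx); exact: (xgetI point Qx).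
Qed.

End dyadic.

(** * The energy form and averages *)

Section gagliardo.
Context {R : realType} {d : measure_display} {X : metricMeasurableType d R}.
Variable mu : {sigma_finite_measure set X -> \bar R}.
Variables gamma s : R.
Hypothesis gamma_gt0 : 0 < gamma.
Hypothesis s_gt : gamma / 2 < s.
Hypothesis mdist_measurable :
  measurable_fun setT (fun z : X * X => mdist z.1 z.2).
Implicit Types (u v w : X -> R) (A B : set X).

Let s_gt0 : 0 < s. Proof. by move: gamma_gt0 s_gt; lra. Qed.

Let gamma_2s_gt0 : 0 < gamma + 2 * s.
Proof. by move: gamma_gt0 s_gt; lra. Qed.

Let s_neq0 : s != 0. Proof. by rewrite gt_eqF. Qed.

Let gamma_neq0 : gamma != 0. Proof. by rewrite gt_eqF. Qed.

Let s_gamma2_neq0 : s + gamma / 2 != 0.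
Proof. by rewrite gt_eqF//; move: gamma_gt0 s_gt; lra. Qed.

Let gamma_2s_neq0 : gamma + 2 * s != 0. Proof. by rewrite gt_eqF. Qed.

(** The square root of the kernel [d(x, y)^-(gamma + 2 s)], which turns the form into an L^2 inner
    product of quotients. On the diagonal it is the inverse of 0, that is 0. *)
Definition gkernel (z : X * X) : R := (mdist z.1 z.2 `^ (s + gamma / 2))^-1.

(** The first coordinate plays the part of [y], the outer variable of [energy] and
    [bilinear_form]. *)
Definition gquot u (z : X * X) : R := (u z.2 - u z.1) * gkernel z.

Definition gform u v : R := dot (mu \x mu)%E (gquot u) (gquot v).

Definition gfun u (y : X) : \bar R := (\int[mu]_x (gquot u (y, x) ^+ 2)%:E)%E.

Lemma gkernel_sqr x y :
  gkernel (y, x) ^+ 2 = (mdist x y `^ (gamma + 2 * s))^-1.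
Proof.
rewrite /gkernel /= exprVn metric_sym; congr (_^-1).
have [->|r0] := eqVneq (mdist x y) 0.
  by rewrite !powR0 ?expr0n.
rewrite expr2 -powRD; first by congr (_ `^ _); lra.
by rewrite r0 implybT.
Qed.

Lemma measurable_gkernel : measurable_fun setT gkernel.
Proof.
rewrite (_ : gkernel = fun z => mdist z.1 z.2 `^ (- (s + gamma / 2))).
  exact: (measurableT_comp (measurable_powR _)).
by apply/funext => z; rewrite powRN.
Qed.

Lemma measurable_gquot u : measurable_fun setT u ->
  measurable_fun setT (gquot u).
Proof.
move=> um; apply: measurable_funM; last exact: measurable_gkernel.
by apply: measurable_funB; exact: measurableT_comp.
Qed.

Lemma gquotD u v : gquot (u + v) = gquot u + gquot v.
Proof. by apply/funext => z; rewrite /gquot /= !fctE; ring. Qed.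

Lemma gquotZ (a : R) u : gquot (a *: u) = a *: gquot u.
Proof.
by apply/funext => z; rewrite /gquot !fctE /= /GRing.scale /=; ring.
Qed.

Lemma measurable_gquot_sqr u : measurable_fun setT u ->
  measurable_fun setT (fun z => (gquot u z ^+ 2)%:E).
Proof.
by move=> ?; apply/measurable_EFinP/measurable_funX; exact: measurable_gquot.
Qed.

Lemma measurable_gfun u : measurable_fun setT u -> measurable_fun setT (gfun u).
Proof.
move=> um; apply: (measurable_fun_fubini_tonelli_F
  (fun z => (gquot u z ^+ 2)%:E)).
- exact: measurable_gquot_sqr.
- by move=> z; rewrite lee_fin sqr_ge0.
Qed.

Lemma gfun_ge0 u y : (0 <= gfun u y)%E.
Proof. by apply: integral_ge0 => x _; rewrite lee_fin sqr_ge0. Qed.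

Lemma integral_gfun u : measurable_fun setT u ->
  (\int[mu]_y gfun u y = \int[mu \x mu]_z (gquot u z ^+ 2)%:E)%E.
Proof.
move=> um; rewrite (fubini_tonelli1 (fun z => (gquot u z ^+ 2)%:E))//.
- exact: measurable_gquot_sqr.
- by move=> z; rewrite lee_fin sqr_ge0.
Qed.

Lemma integral_gfunZ u (c : R) : measurable_fun setT u -> 0 <= c ->
  (\int[mu]_y \int[mu]_x (c * gquot u (y, x) ^+ 2)%:E
   = c%:E * \int[mu]_y gfun u y)%E.
Proof.
move=> um c0; rewrite integral_gfun// -ge0_integralZl//.
- rewrite (fubini_tonelli1 (fun z => (c%:E * (gquot u z ^+ 2)%:E)%E))//.
  + by apply: measurable_funeM; exact: measurable_gquot_sqr.
  + by move=> z; rewrite mule_ge0 ?lee_fin ?sqr_ge0.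
- exact: measurable_gquot_sqr.
- by move=> z _; rewrite lee_fin sqr_ge0.
Qed.

Lemma gform_gfun u : sqint mu u -> sqint (mu \x mu)%E (gquot u) ->
  (gform u u)%:E = (\int[mu]_y gfun u y)%E.
Proof. by move=> [um _] su; rewrite /gform EFin_dot// integral_gfun. Qed.

Lemma bilinear_formE u v :
  sqint (mu \x mu)%E (gquot u) -> sqint (mu \x mu)%E (gquot v) ->
  bilinear_form mu gamma s u v = (gform u v)%:E.
Proof.
move=> su sv; have iuv := integrable_dot su sv.
rewrite /gform /dot /Rintegral fineK; last exact: integrable_fin_num iuv.
rewrite -(integral12_prod_meas1 iuv) /fubini_F /bilinear_form.
apply: eq_integral => y _; apply: eq_integral => x _ /=; congr EFin.
rewrite /gquot /=.
transitivity ((u x - u y) * (v x - v y) * gkernel (y, x) ^+ 2); last by ring.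
rewrite gkernel_sqr; have [->|r0] := eqVneq (mdist x y) 0.
  by rewrite !powR0 ?invr0 ?mulr0.
have -> : gamma + 2 * s = s + s + gamma by lra.
rewrite !powRD ?r0 ?implybT//.
by field; rewrite !powR_eq0 (negbTE r0).
Qed.

Section sobolev.
Hypothesis regular : ahlfors_regular mu gamma.

Lemma energy_kernel_bounds : exists2 ab : R * R, 0 < ab.1 /\ 0 < ab.2 &
  forall x y, ab.1 * gkernel (y, x) ^+ 2 <=
    (fine (mu (ball x (mdist x y))) `^ (1 + 2 * (s / gamma)))^-1 <=
    ab.2 * gkernel (y, x) ^+ 2.
Proof.
have [c1 [c2 [c10 c20 creg]]] := regular.
set p := 1 + 2 * (s / gamma).
have p0 : 0 < p by rewrite addr_gt0// mulr_gt0// divr_gt0.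
exists ((c2 `^ p)^-1, (c1 `^ p)^-1).
  by split; rewrite invr_gt0 powR_gt0.
move=> x y /=; rewrite gkernel_sqr -!invfM.
have [xy0|xy0] := eqVneq (mdist x y) 0.
  rewrite xy0 !ballEmdist (_ : [set y0 | _] = set0); last first.
    by apply/seteqP; split=> z //=; rewrite ltNge mdist_ge0.
  by rewrite measure0/= !powR0 ?mulr0 ?invr0 ?lexx// gt_eqF.
have r0 : 0 < mdist x y by rewrite lt_neqAle eq_sym xy0 mdist_ge0.
have /andP[m1 m2] := creg x _ r0.
have mfin : mu (ball x (mdist x y)) \is a fin_num.
  by rewrite ge0_fin_numE//; apply: le_lt_trans m2 _; rewrite ltry.
have {}m1 : c1 * mdist x y `^ gamma <= fine (mu (ball x (mdist x y))).
  by rewrite -lee_fin fineK.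
have {}m2 : fine (mu (ball x (mdist x y))) <= c2 * mdist x y `^ gamma.
  by rewrite -lee_fin fineK.
have gE : mdist x y `^ (gamma + 2 * s) = (mdist x y `^ gamma) `^ p.
  rewrite -powRrM; congr (_ `^ _).
  by rewrite /p mulrDr mulr1; field; rewrite gt_eqF.
have pow_ge0 : 0 <= mdist x y `^ gamma by exact: powR_ge0.
have l0 : 0 < c1 * mdist x y `^ gamma by rewrite mulr_gt0// powR_gt0.
rewrite gE -!powRM ?(ltW c10) ?(ltW c20)//.
rewrite !lef_pV2 ?posrE ?powR_gt0//; first last.
- exact: lt_le_trans l0 m1.
- by rewrite mulr_gt0// powR_gt0.
- exact: lt_le_trans l0 m1.
by apply/andP; split; apply: ge0_ler_powR; rewrite ?nnegrE ?(ltW p0)//;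
  rewrite ?(ltW l0)// ?fine_ge0// ?mulr_ge0// ltW.
Qed.

(** The integrands are comparable pointwise by [energy_kernel_bounds]. The integrals are compared
    through [nonneg_le_integral], as measurability of the ball-measure kernel is not at hand. *)
Lemma sobolevP u : sobolev mu (s / gamma) u <->
  sqint mu u /\ sqint (mu \x mu)%E (gquot u).
Proof.
have [[a b] /= [a0 b0] ab] := energy_kernel_bounds.
have intE x y : `|u x - u y| ^+ 2 /
    fine (mu (ball x (mdist x y))) `^ (1 + 2 * (s / gamma)) =
    (u x - u y) ^+ 2 / fine (mu (ball x (mdist x y))) `^ (1 + 2 * (s / gamma)).
  by rewrite real_normK ?num_real.
have lo x y : a * gquot u (y, x) ^+ 2 <= `|u x - u y| ^+ 2 /
    fine (mu (ball x (mdist x y))) `^ (1 + 2 * (s / gamma)).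
  rewrite intE /gquot /= exprMn mulrCA ler_wpM2l ?sqr_ge0//.
  by have /andP[] := ab x y.
have hi x y : `|u x - u y| ^+ 2 /
    fine (mu (ball x (mdist x y))) `^ (1 + 2 * (s / gamma)) <=
    b * gquot u (y, x) ^+ 2.
  rewrite intE /gquot /= exprMn [leRHS]mulrCA ler_wpM2l ?sqr_ge0//.
  by have /andP[] := ab x y.
split=> [[/Lfun2P su eu]|[su [_ gu]]].
  have [um _] := su; split=> //; split; first exact: measurable_gquot.
  rewrite -integral_gfun//.
  suff : (a%:E * \int[mu]_y gfun u y < +oo)%E.
    have : (0 <= \int[mu]_y gfun u y)%E.
      by apply: integral_ge0 => y _; exact: gfun_ge0.
    by case: (\int[mu]_y gfun u y)%E => [r|//|//]; rewrite ?ltry ?gt0_muley.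
  rewrite -integral_gfunZ ?(ltW a0)//; apply: le_lt_trans eu.
  apply: nonneg_le_integral => y.
    by apply: integral_ge0 => x _; rewrite lee_fin mulr_ge0 ?sqr_ge0 ?ltW.
  apply: nonneg_le_integral => x; rewrite lee_fin.
    by rewrite mulr_ge0 ?sqr_ge0 ?ltW.
  exact: lo.
have [um _] := su; split; first exact/Lfun2P.
apply: (@le_lt_trans _ _ (b%:E * \int[mu]_y gfun u y)%E); last first.
  rewrite integral_gfun// lte_mul_pinfty// lee_fin ltW//.
rewrite -integral_gfunZ ?(ltW b0)//.
have ig0 x y : 0 <= `|u x - u y| ^+ 2 /
    fine (mu (ball x (mdist x y))) `^ (1 + 2 * (s / gamma)).
  by rewrite divr_ge0 ?sqr_ge0 ?powR_ge0.
apply: nonneg_le_integral => y.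
  by apply: integral_ge0 => x _; rewrite lee_fin.
by apply: nonneg_le_integral => x; rewrite lee_fin.
Qed.

End sobolev.

Definition near_set (rho : R) (x : X) A := forall y, A y -> mdist x y <= rho.

Lemma gquot_near v (rho : R) x y : mdist x y <= rho ->
  (v x - v y) ^+ 2 <= rho `^ (gamma + 2 * s) * gquot v (x, y) ^+ 2.
Proof.
move=> xyr; rewrite /gquot exprMn gkernel_sqr /= metric_sym.
have [xy0|xy0] := eqVneq (mdist x y) 0.
  by rewrite (mdist_positivity _ _ xy0) !subrr expr0n !mul0r mulr0.
have r0 : 0 < mdist x y by rewrite lt_neqAle eq_sym xy0 mdist_ge0.
have -> : (v y - v x) ^+ 2 = (v x - v y) ^+ 2 by ring.
rewrite mulrCA ler_peMr ?sqr_ge0// ler_pdivlMr ?powR_gt0// mul1r.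
by apply: ge0_ler_powR; rewrite ?nnegrE ?mdist_ge0 ?(ltW gamma_2s_gt0)
  ?(le_trans _ xyr) ?mdist_ge0.
Qed.

(** After Jensen, the squared kernel is inserted at the cost of [rho ^ (gamma + 2 s)], since points
    of [A] lie within [rho] of [x]. *)
Lemma avg_point_le v A (rho : R) x : sqint mu v -> measurable A ->
  (0 < mu A < +oo)%E -> near_set rho x A ->
  ((fine (mu A) * (v x - avg mu A v) ^+ 2)%:E <=
   (rho `^ (gamma + 2 * s))%:E * gfun v x)%E.
Proof.
move=> sv mA mA0 nA; apply: (le_trans (avg_jensen (v x) sv mA mA0)).
have [mv _] := sv.
rewrite -ge0_integralZl//.
- apply: nonneg_le_integral => y; first by rewrite lee_fin sqr_ge0.
  rewrite -EFinM lee_fin indicE.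
  have [/set_mem Ay|_] := boolP (y \in A).
    by rewrite mulr1; apply/gquot_near/nA.
  by rewrite mulr0 expr0n mulr_ge0 ?powR_ge0 ?sqr_ge0.
- apply/measurable_EFinP; apply: measurable_funX.
  exact: (measurableT_comp (measurable_gquot mv)).
- by move=> y _; rewrite lee_fin sqr_ge0.
- by rewrite lee_fin powR_ge0.
Qed.

(** Jensen over [A] with the constant [avg mu B v] reduces the claim to [avg_point_le] for [B] at
    each point of [A]; integrating and enlarging [A] to [X] gives the full form. *)
Lemma avg_avg_le v A B (rho : R) : sqint mu v ->
  sqint (mu \x mu)%E (gquot v) -> measurable A -> measurable B ->
  (0 < mu A < +oo)%E -> (0 < mu B < +oo)%E ->
  (forall x, A x -> near_set rho x B) ->
  fine (mu A) * fine (mu B) * (avg mu A v - avg mu B v) ^+ 2 <=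
  rho `^ (gamma + 2 * s) * gform v v.
Proof.
move=> sv sg mA mB A0 B0 AB; have [mv _] := sv.
have bB0 : 0 <= fine (mu B) by exact: fine_ge0.
rewrite (mulrC (fine (mu A))) -mulrA.
rewrite -lee_fin [in leRHS]EFinM gform_gfun// EFinM.
have := avg_jensen (avg mu B v) sv mA A0.
have -> : (avg mu B v - avg mu A v) ^+ 2 = (avg mu A v - avg mu B v) ^+ 2 by ring.
rewrite -(@lee_pmul2l _ (fine (mu B))%:E); last 2 first.
- by [].
- have /andP[B1 B2] := B0.
  by rewrite lte_fin fine_gt0// B1.
move=> /le_trans; apply.
have rho_ge0 : (0 <= (rho `^ (gamma + 2 * s))%:E)%E by rewrite lee_fin powR_ge0.
have mgv := measurable_gfun mv.
have mAv : measurable_fun setT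
    (fun x => (((avg mu B v - v x) * \1_A x) ^+ 2)%:E).
  apply/measurable_EFinP; apply: measurable_funX; apply: measurable_funM => //.
  exact: measurable_funB.
rewrite -ge0_integralZl//; last by move=> x _; rewrite lee_fin sqr_ge0.
rewrite -ge0_integralZl//; last by move=> x _; exact: gfun_ge0.
apply: nonneg_le_integral => x.
  by rewrite mule_ge0// lee_fin// sqr_ge0.
have [/set_mem Ax|/negbTE xA] := boolP (x \in A); rewrite -EFinM.
- apply: le_trans (avg_point_le sv mB B0 (AB x Ax)).
  rewrite lee_fin indicE mem_set// mulr1 ler_wpM2l//.
  by have -> : (avg mu B v - v x) ^+ 2 = (v x - avg mu B v) ^+ 2 by ring.
- by rewrite indicE xA mulr0 expr0n mulr0 mule_ge0// gfun_ge0.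
Qed.

End gagliardo.

(** * The continuous representative *)

Lemma geometric_cvg {R : realType} (a : nat -> R) (K q : R) : 0 < q < 1 ->
  (forall k, `|a k.+1 - a k| <= K * q ^+ k) ->
  a @ \oo --> lim (a @ \oo) /\
  forall k, `|lim (a @ \oo) - a k| <= K / (1 - q) * q ^+ k.
Proof.
move=> /andP[q0 q1] aK.
have K0 : 0 <= K by have := aK 0%N; rewrite expr0 mulr1; apply: le_trans.
have p0 : 0 < 1 - q by lra.
set M := K / (1 - q).
have M0 : 0 <= M by rewrite divr_ge0// ltW.
have KE : K = M * (1 - q) by rewrite /M mulfVK// gt_eqF.
(* Since [K = M * (1 - q)], the bound on one increment is [M * (q ^+ k - q ^+ k.+1)], which
   telescopes. *)
have tele k n : `|a (k + n)%N - a k| <= M * (q ^+ k - q ^+ (k + n)).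
  elim: n => [|n IH]; first by rewrite addn0 !subrr normr0 mulr0.
  rewrite addnS.
  have -> : a (k + n).+1 - a k =
    (a (k + n).+1 - a (k + n)%N) + (a (k + n)%N - a k) by ring.
  apply: (le_trans (ler_normD _ _)).
  have := aK (k + n)%N; rewrite KE exprS => H.
  apply: (le_trans (lerD H IH)); rewrite le_eqVlt; apply/orP; left.
  by apply/eqP; ring.
have bnd k n : (k <= n)%N -> `|a n - a k| <= M * q ^+ k.
  move=> kn; rewrite -(subnKC kn); apply: (le_trans (tele _ _)).
  by rewrite ler_wpM2l// gerBl exprn_ge0// ltW.
have ca : cvgn a.
  apply/cauchy_cvgP/cauchy_exP => e e0.
  have [|N HN] := @geometric_small _ M q e _ e0; first exact/andP.
  exists (a N); exists N => // n /= Nn; rewrite /ball /= distrC.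
  exact: le_lt_trans (bnd _ _ Nn) HN.
split=> // k.
have -> : lim (a @ \oo) - a k = lim ((fun n => a n - a k) @ \oo).
  by rewrite limB//; [rewrite lim_cst|exact: is_cvg_cst].
rewrite -lim_norm; last by apply: is_cvgB => //; exact: is_cvg_cst.
apply: limr_le.
  by apply: is_cvg_norm; apply: is_cvgB => //; exact: is_cvg_cst.
by near=> n; apply: bnd; near: n; exists k.
Unshelve. all: by end_near. Qed.

Section continuous_representative.
Context {R : realType} {d : measure_display} {X : metricMeasurableType d R}.
Variable mu : {sigma_finite_measure set X -> \bar R}.
Variables gamma s : R.
Hypothesis borelX : is_borel X.
Hypothesis gamma_gt0 : 0 < gamma.
Hypothesis s_gt : gamma / 2 < s.
Hypothesis mdist_measurable :
  measurable_fun setT (fun z : X * X => mdist z.1 z.2).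
Variables c1 c2 : R.
Hypothesis c1_gt0 : 0 < c1.
Hypothesis muball : forall (x : X) (r : R), 0 < r ->
  ((c1 * r `^ gamma)%:E <= mu (ball x r) <= (c2 * r `^ gamma)%:E)%E.

Local Notation gquot := (gquot gamma s).
Local Notation gform := (gform mu gamma s).
Local Notation gfun := (gfun mu gamma s).
Local Notation avg := (avg mu).
Implicit Types (v : X -> R) (x y : X).

Let s_gt0 : 0 < s. Proof. by move: gamma_gt0 s_gt; lra. Qed.

Let alpha := s - gamma / 2.

Let alpha_gt0 : 0 < alpha. Proof. by rewrite subr_gt0. Qed.

Lemma mu_ball_fin x r : 0 < r -> (0 < mu (ball x r) < +oo)%E.
Proof.
move=> r0; have /andP[m1 m2] := muball x r0; apply/andP; split.
  by apply: lt_le_trans m1; rewrite lte_fin mulr_gt0// powR_gt0.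
by apply: le_lt_trans m2 _; rewrite ltry.
Qed.

Lemma mu_ball_ge x r : 0 < r -> c1 * r `^ gamma <= fine (mu (ball x r)).
Proof.
move=> r0; have /andP[m1 m2] := muball x r0; rewrite -lee_fin fineK//.
by have /andP[m0 moo] := mu_ball_fin x r0; rewrite ge0_fin_numE.
Qed.

(** The 3 bounds the distance, in units of [r], between points of the two balls; the denominator
    comes from the lower bounds [c1 * r ^ gamma] and [c1 * (r / 2) ^ gamma] of their measures. *)
Definition holder_cst : R :=
  3 `^ (gamma + 2 * s) / (c1 ^+ 2 * 2^-1 `^ gamma).

(** The range of [r'] covers both uses: halved radius at one centre, and equal radii at two centres.
    Dividing [r ^ (gamma + 2 s)] by [r ^ (2 gamma)] leaves [(r ^ alpha) ^ 2]. *)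
Lemma ball_avg_sqr_le v x y (r r' : R) : sqint mu v ->
  sqint (mu \x mu)%E (gquot v) -> 0 < r -> r / 2 <= r' <= r -> mdist x y <= r ->
  (avg (ball x r) v - avg (ball y r') v) ^+ 2 <=
  holder_cst * gform v v * (r `^ alpha) ^+ 2.
Proof.
move=> sv sg r0 /andP[r'1 r'2] xyr.
have r'0 : 0 < r' by lra.
have near_xy z : ball x r z -> near_set (3 * r) z (ball y r').
  rewrite ballEmdist /= => xz t; rewrite ballEmdist /= => yt.
  have := metric_triangle z x t; have := metric_triangle x y t.
  by rewrite (metric_sym z x); lra.
have := avg_avg_le gamma_gt0 s_gt mdist_measurable sv sg
  (measurable_metric_ball borelX x r) (measurable_metric_ball borelX y r')
  (mu_ball_fin x r0) (mu_ball_fin y r'0) near_xy.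
set D2 := (_ - _) ^+ 2; set E := gform v v.
have D0 : 0 <= D2 by exact: sqr_ge0.
have P0 : 0 < r `^ gamma by exact: powR_gt0.
set P := r `^ gamma in P0 *.
pose h : R := 2^-1 `^ gamma.
have h0 : 0 < h by rewrite powR_gt0.
have m1 : c1 * P <= fine (mu (ball x r)) by exact: mu_ball_ge.
have m2 : c1 * (h * P) <= fine (mu (ball y r')).
  apply: le_trans (mu_ball_ge y r'0); rewrite ler_pM2l//.
  rewrite /h /P -powRM ?(ltW r0)//.
  by apply: ge0_ler_powR; rewrite ?nnegrE ?(ltW gamma_gt0)//; lra.
have SE : (3 * r) `^ (gamma + 2 * s) =
    3 `^ (gamma + 2 * s) * ((r `^ alpha) ^+ 2 * P ^+ 2).
  rewrite powRM ?(ltW r0)//; congr (_ * _).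
  have -> : gamma + 2 * s = alpha + alpha + (gamma + gamma) by rewrite /alpha; lra.
  have rn0 : r != 0 by rewrite gt_eqF.
  by rewrite !powRD ?rn0 ?implybT// !expr2.
rewrite SE /holder_cst -/h => H.
set T := 3 `^ _ in H *; set A2 := (r `^ alpha) ^+ 2 in H *.
have H2 : c1 * P * (c1 * (h * P)) * D2 <= T * (A2 * P ^+ 2) * E.
  apply: le_trans H; apply: ler_wpM2r => //.
  by apply: ler_pM => //; rewrite !mulr_ge0// ltW.
have Q0 : 0 < c1 ^+ 2 * h by rewrite mulr_gt0// exprn_gt0.
rewrite -(ler_pM2r Q0) -(ler_pM2r (exprn_gt0 2 P0)).
have -> : T / (c1 ^+ 2 * h) * E * A2 * (c1 ^+ 2 * h) * P ^+ 2 =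
    T * (A2 * P ^+ 2) * E.
  by field; rewrite !gt_eqF.
apply: le_trans H2; rewrite le_eqVlt; apply/orP; left; apply/eqP; ring.
Qed.

Lemma holder_cst_ge0 : 0 <= holder_cst.
Proof. by rewrite divr_ge0 ?powR_ge0// mulr_ge0 ?powR_ge0// sqr_ge0. Qed.

Let K v := Num.sqrt (holder_cst * gform v v).

Let Ksqr v : K v ^+ 2 = holder_cst * gform v v.
Proof. by rewrite sqr_sqrtr// mulr_ge0 ?holder_cst_ge0// dot_ge0. Qed.

Lemma ball_avg_le v x y (r r' : R) : sqint mu v ->
  sqint (mu \x mu)%E (gquot v) -> 0 < r -> r / 2 <= r' <= r -> mdist x y <= r ->
  `|avg (ball x r) v - avg (ball y r') v| <= K v * r `^ alpha.
Proof.
move=> sv sg r0 rr' xyr.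
have := ball_avg_sqr_le sv sg r0 rr' xyr; rewrite -Ksqr -exprMn.
rewrite -[in X in X <= _ -> _]real_normK ?num_real//.
by rewrite ler_pXn2r ?nnegrE ?mulr_ge0 ?sqrtr_ge0 ?powR_ge0.
Qed.

Definition dyadic_avg v x (k : nat) : R := avg (ball x (2^-1 ^+ k)) v.

Definition rep v x : R := lim (dyadic_avg v x @ \oo).

(** The factor by which [r ^ alpha] shrinks when the radius is halved. *)
Let theta : R := 2^-1 `^ alpha.

Let powR_half_lt1 (p : R) : 0 < p -> 2^-1 `^ p < 1.
Proof.
move=> p0; have {2}<- : 1 `^ p = 1 :> R by rewrite powR1.
by apply: gt0_ltr_powR; rewrite ?nnegrE// invf_lt1// ltr1n.
Qed.

Let theta01 : 0 < theta < 1.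
Proof. by rewrite powR_gt0//= powR_half_lt1. Qed.

Let pow_theta k : (2^-1 ^+ k) `^ alpha = theta ^+ k.
Proof.
by rewrite -!powR_mulrn ?powR_ge0// -!powRrM mulrC.
Qed.

Let half_gt0 k : 0 < 2^-1 ^+ k :> R. Proof. by rewrite exprn_gt0// invr_gt0. Qed.

Section fixed_v.
Variable v : X -> R.
Hypotheses (sv : sqint mu v) (sg : sqint (mu \x mu)%E (gquot v)).

Let step x k : `|dyadic_avg v x k.+1 - dyadic_avg v x k| <= K v * theta ^+ k.
Proof.
rewrite distrC -pow_theta /dyadic_avg; apply: ball_avg_le => //.
- by rewrite exprS mulrC lexx/= ger_pMl// invf_le1// ler1n.
- by rewrite mdistxx ltW.
Qed.

Lemma rep_cvg x : dyadic_avg v x @ \oo --> rep v x.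
Proof. by have [] := geometric_cvg theta01 (step x). Qed.

Lemma rep_dist x k :
  `|rep v x - dyadic_avg v x k| <= K v / (1 - theta) * theta ^+ k.
Proof. by have [] := geometric_cvg theta01 (step x). Qed.

Lemma rep_continuous : continuous (rep v).
Proof.
move=> x; apply/cvgrPdist_lt => e e0.
(* Two errors from [rep_dist], at [x] and at [y], and one from [ball_avg_le] between the two
   balls. *)
pose M := 2 * (K v / (1 - theta)) + K v.
have [k Hk] := geometric_small M theta01 e0.
have := nbhsx_ballx x _ (half_gt0 k); apply: filterS => y.
rewrite ballEmdist /= => xy; apply: le_lt_trans Hk.
have H1 := rep_dist x k; have H2 := rep_dist y k.
have H3 : `|dyadic_avg v x k - dyadic_avg v y k| <= K v * theta ^+ k.
  rewrite -pow_theta; apply: ball_avg_le => //; last exact: ltW.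
  by rewrite lexx andbT ler_pdivrMr// ler_peMr ?ler1n// ltW.
have -> : rep v x - rep v y = (rep v x - dyadic_avg v x k) +
  (dyadic_avg v x k - dyadic_avg v y k) - (rep v y - dyadic_avg v y k) by ring.
apply: (le_trans (ler_normB _ _)).
apply: (le_trans (lerD (ler_normD _ _) (lexx _))).
by rewrite /M; move: H1 H2 H3; set q := theta ^+ k; lra.
Qed.

(* At a point where [gfun v] is finite, [v] differs from its average over
   [ball x r] by [O(r `^ s)], so no differentiation theorem is needed. *)
Lemma rep_eq x : (gfun v x < +oo)%E -> rep v x = v x.
Proof.
move=> Fx.
have Ffin : gfun v x \is a fin_num by rewrite ge0_fin_numE// gfun_ge0.
set F := fine (gfun v x).
have F0 : 0 <= F by rewrite fine_ge0// gfun_ge0.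
have bound k : (v x - dyadic_avg v x k) ^+ 2 <= F / c1 * ((2^-1 `^ (2 * s)) ^+ k).
  set r : R := 2^-1 ^+ k; have r0 : 0 < r by exact: half_gt0.
  have nr : near_set r x (ball x r) by move=> y; rewrite ballEmdist => /ltW.
  have := avg_point_le gamma_gt0 s_gt mdist_measurable sv
    (measurable_metric_ball borelX x r) (mu_ball_fin x r0) nr.
  rewrite -(fineK Ffin) -EFinM lee_fin -/F => H.
  have P0 : 0 < r `^ gamma by exact: powR_gt0.
  have H2 : c1 * r `^ gamma * (v x - dyadic_avg v x k) ^+ 2 <=
      r `^ (gamma + 2 * s) * F.
    by apply: le_trans H; rewrite ler_wpM2r ?sqr_ge0// mu_ball_ge.
  have -> : (2^-1 `^ (2 * s)) ^+ k = r `^ (2 * s) :> R.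
    by rewrite /r -!powR_mulrn ?powR_ge0// -!powRrM mulrC.
  have rn0 : r != 0 by rewrite gt_eqF.
  move: H2; rewrite powRD ?rn0 ?implybT// => H2.
  have Q0 : 0 < c1 * r `^ gamma by rewrite mulr_gt0.
  rewrite -(ler_pM2l Q0); apply: (le_trans H2).
  rewrite le_eqVlt; apply/orP; left; apply/eqP.
  by field; rewrite gt_eqF.
apply/eqP; rewrite -subr_eq0 -sqrf_eq0 eq_le sqr_ge0 andbT.
have cv : (fun k => (v x - dyadic_avg v x k) ^+ 2) @ \oo --> (v x - rep v x) ^+ 2.
  have cw : (fun k => v x - dyadic_avg v x k) @ \oo --> v x - rep v x.
    by apply: cvgB; [exact: cvg_cst|exact: rep_cvg].
  by rewrite expr2; under eq_fun do rewrite expr2; exact: cvgM.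
have c0 : (fun k => F / c1 * (2^-1 `^ (2 * s)) ^+ k) @ \oo --> (0 : R).
  rewrite -[X in _ --> X](mulr0 (F / c1)); apply: cvgMr.
  apply: cvg_expr; rewrite ger0_norm ?powR_ge0//.
  by rewrite powR_half_lt1// mulr_gt0.
have -> : (rep v x - v x) ^+ 2 = (v x - rep v x) ^+ 2 by ring.
apply: (ler_cvg_to cv c0); exact: nearW.
Qed.

(** The integral of [gfun v] is the finite number [gform v v], so [gfun v] is finite almost
    everywhere and [rep_eq] applies there. *)
Lemma rep_ae : v = rep v %[ae mu].
Proof.
have [mv _] := sv; have mg := measurable_gfun mu gamma s mdist_measurable mv.
have : mu.-integrable setT (gfun v).
  apply/integrableP; split; first exact: mg.
  under eq_integral do rewrite gee0_abs ?gfun_ge0//.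
  by rewrite -gform_gfun// ltry.
move=> /integrable_ae => /(_ measurableT); apply: filterS => x /= Fx _.
rewrite rep_eq//; have := Fx I; rewrite fin_numE => /andP[_].
by rewrite ltey.
Qed.

(** With [p] the average over the unit ball at [x], the term [rep v x - p] is controlled by
    [rep_dist] at [k = 0], and [p] by comparison with the zero average over [A], whose points lie
    within [1 + rho] of the ball. *)
Lemma rep_sqr_le (rho a : R) x A : 0 <= rho -> 0 < a -> measurable A ->
  (0 < mu A < +oo)%E -> a <= fine (mu A) -> near_set rho x A -> avg A v = 0 ->
  rep v x ^+ 2 <= (2 * holder_cst / (1 - theta) ^+ 2 +
     2 * (1 + rho) `^ (gamma + 2 * s) / (c1 * a)) * gform v v.
Proof.
move=> rho0 a0 mA A0 Aa nA avg0.
have r1 : 0 < 1 :> R by [].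
have nearA z : ball x 1 z -> near_set (1 + rho) z A.
  rewrite ballEmdist /= => xz t /nA xt; have := metric_triangle z x t.
  by rewrite (metric_sym z x); lra.
have := avg_avg_le gamma_gt0 s_gt mdist_measurable sv sg
  (measurable_metric_ball borelX x 1) mA (mu_ball_fin x r1) A0 nearA.
rewrite avg0 subr0; set p := avg (ball x 1) v => H.
have H1 : p ^+ 2 <= (1 + rho) `^ (gamma + 2 * s) / (c1 * a) * gform v v.
  have ca : 0 < c1 * a by rewrite mulr_gt0.
  rewrite mulrAC ler_pdivlMr// [leLHS]mulrC.
  apply: le_trans H; rewrite ler_wpM2r ?sqr_ge0//.
  apply: ler_pM => //; rewrite ?(ltW c1_gt0) ?(ltW a0)//.
  by have := mu_ball_ge x r1; rewrite powR1 mulr1.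
have H2 : (rep v x - p) ^+ 2 <= holder_cst / (1 - theta) ^+ 2 * gform v v.
  have := rep_dist x 0; rewrite expr0 mulr1 /dyadic_avg expr0 -/p => H2.
  have -> : holder_cst / (1 - theta) ^+ 2 * gform v v = (K v / (1 - theta)) ^+ 2.
    by rewrite expr_div_n Ksqr mulrAC.
  rewrite -[leLHS]real_normK ?num_real//.
  rewrite ler_pXn2r ?nnegrE ?(le_trans _ H2)//.
(* This square gives [q ^+ 2 <= 2 * (q - p) ^+ 2 + 2 * p ^+ 2] for [q = rep v x]. *)
have := sqr_ge0 (rep v x - 2 * p).
move: H1 H2; rewrite mulrDl -!mulrA.
set e := gform v v; set q := rep v x.
by move: ((1 + rho) `^ _) => t; lra.
Qed.

(** With a zero average, [avg_point_le] bounds [v x ^+ 2] by a multiple of [gfun v x], uniformly in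
    [x]; then integrate. *)
Lemma poincare (rho a : R) : 0 < a ->
  (forall x, exists A, [/\ measurable A, (0 < mu A < +oo)%E, a <= fine (mu A),
     near_set rho x A & avg A v = 0]) ->
  dot mu v v <= rho `^ (gamma + 2 * s) / a * gform v v.
Proof.
move=> a0 HA; have [mv _] := sv.
have c0 : 0 <= rho `^ (gamma + 2 * s) / a by rewrite divr_ge0 ?powR_ge0// ltW.
rewrite -lee_fin EFinM EFin_dot// gform_gfun// -ge0_integralZl//; first last.
- by move=> x _; exact: gfun_ge0.
- exact: measurable_gfun.
apply: nonneg_le_integral => x; first by rewrite lee_fin sqr_ge0.
have [A [mA A0 Aa nA avg0]] := HA x.
have := avg_point_le gamma_gt0 s_gt mdist_measurable sv mA A0 nA.
rewrite avg0 subr0 => H.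
rewrite -(@lee_pmul2l _ a%:E)// muleA -!EFinM.
have -> : a * (rho `^ (gamma + 2 * s) / a) = rho `^ (gamma + 2 * s).
  by rewrite mulrC mulfVK// gt_eqF.
by apply: le_trans H; rewrite lee_fin ler_wpM2r ?sqr_ge0.
Qed.

End fixed_v.
End continuous_representative.

(** * Vanishing means *)

Section zero_mean.
Context {R : realType} {d : measure_display} {X : metricMeasurableType d R}.
Variable mu : {measure set X -> \bar R}.
Variables (gamma : R) (D : int -> set (set X)) (h : set X -> nat -> X -> R).
Hypothesis gamma_gt0 : 0 < gamma.
Hypothesis borelX : is_borel X.
Hypothesis dyD : dyadic_family D.
Hypothesis haarD : haar_system mu D h.
Variables c1 c2 : R.
Hypothesis c1_gt0 : 0 < c1.
Hypothesis muball : forall (x : X) (r : R), 0 < r ->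
  ((c1 * r `^ gamma)%:E <= mu (ball x r) <= (c2 * r `^ gamma)%:E)%E.

(** The diameter is at most [2 * r2], so [r2 >= a1 * nu ^ j / 2]; hence the inner ball has radius at
    least [a3 * a1 / 2 * nu ^ j], and regularity bounds its measure from below. *)
Lemma cube_size : exists nu b c : R, [/\ 0 < nu < 1, 0 < b, 0 < c &
  forall j Q, D j Q -> [/\ (0 < mu Q < +oo)%E, b * (nu ^ j) `^ gamma <= fine (mu Q)
    & forall x y, Q x -> Q y -> mdist x y <= c * nu ^ j]].
Proof.
have [nu [a1 [a2 [a3 [nu01 a10 a20 a30 Dsize]]]]] := dyadic_size dyD.
have nu0 : 0 < nu by case/andP: nu01.
exists nu, (c1 * (a3 * a1 / 2) `^ gamma), a2; split=> //.
  by rewrite mulr_gt0// powR_gt0// divr_gt0// mulr_gt0.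
move=> j Q jQ; have [/andP[Q1 Q2] [x1 [x2 [r1 [r2 [r10 r20 B1 B2 r12]]]]]] :=
  Dsize _ _ jQ.
have mQ : measurable Q := dyadic_measurable dyD jQ.
have mB x r : measurable (ball x r : set X) by exact: measurable_metric_ball.
have Qoo : (mu Q < +oo)%E.
  apply: (@le_lt_trans _ _ (mu (ball x2 r2))); first by rewrite le_measure// inE.
  by have /andP[_ +] := muball x2 r20 => /le_lt_trans; apply; rewrite ltry.
have nuj : 0 < nu ^ j by rewrite exprz_gt0.
have d2 : a1 * nu ^ j <= 2 * r2.
  rewrite -lee_fin; apply: (le_trans Q1); apply: ub_ereal_sup.
  move=> _ [[y z] [/= Qy Qz] <-]; have := B2 _ Qz; have := B2 _ Qy.
  rewrite !ballEmdist /= lee_fin => y2 z2.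
  by have := metric_triangle y x2 z; rewrite (metric_sym y x2); lra.
have r1_ge : a3 * a1 / 2 * nu ^ j <= r1.
  by apply: le_trans r12; rewrite -!mulrA ler_pM2l//; lra.
have Qge : ((c1 * (a3 * a1 / 2) `^ gamma * (nu ^ j) `^ gamma)%:E <= mu Q)%E.
  apply: (@le_trans _ _ (mu (ball x1 r1))); last by rewrite le_measure// inE.
  have /andP[+ _] := muball x1 r10; apply: le_trans; rewrite lee_fin.
  have q0 : 0 <= a3 * a1 / 2 by rewrite ltW// divr_gt0// mulr_gt0.
  rewrite -mulrA ler_pM2l// -powRM ?(ltW nuj)//.
  by apply: ge0_ler_powR; rewrite ?nnegrE ?(ltW gamma_gt0) ?(ltW r10)//
    mulr_ge0// ltW.
split.
- rewrite Qoo andbT; apply: lt_le_trans Qge; rewrite lte_fin.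
  by rewrite !mulr_gt0 ?powR_gt0// divr_gt0// mulr_gt0.
- by rewrite -lee_fin fineK// ge0_fin_numE.
- by move=> x y Qx Qy; exact: diam_mdist Q2 Qx Qy.
Qed.

Let cube_fin j Q : D j Q -> (0 < mu Q < +oo)%E.
Proof. by have [nu [b [c [_ _ _ HQ]]]] := cube_size; move=> /HQ[]. Qed.

Let sqint_cube j Q : D j Q -> sqint mu \1_Q.
Proof.
move=> jQ; apply: sqint_indic; first exact: (dyadic_measurable dyD jQ).
by have /andP[] := cube_fin jQ.
Qed.

Lemma cube_large (L : R) : exists n : nat, forall m Q, (n <= m)%N ->
  D (- m%:Z) Q -> L < fine (mu Q).
Proof.
have [nu [b [c [nu01 b0 c0 HQ]]]] := cube_size.
have /andP[nu0 nu1] := nu01.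
have q01 : 0 < nu `^ gamma < 1.
  rewrite powR_gt0//=; have <- : 1 `^ gamma = 1 :> R by rewrite powR1.
  by apply: gt0_ltr_powR; rewrite ?nnegrE// ltW.
have /andP[q0 q1] := q01.
have [n Hn] := geometric_small `|L| q01 b0.
exists n => m Q nm /HQ[_ + _]; apply: lt_le_trans.
have -> : (nu ^ (- m%:Z)) `^ gamma = ((nu `^ gamma) ^+ m)^-1.
  rewrite -exprnN -!powR_mulrn ?powR_ge0 ?(ltW nu0)//.
  by rewrite -!powRN -!powRrM; congr (_ `^ _); ring.
rewrite ltr_pdivlMr ?exprn_gt0//; apply: le_lt_trans Hn.
apply: (@le_trans _ _ (`|L| * (nu `^ gamma) ^+ m)).
  by rewrite ler_wpM2r ?ler_norm// exprn_ge0// ltW.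
by rewrite ler_wpM2l// ler_wiXn2l// ltW.
Qed.

(** The finitely many children cover [Q]: preimages are finite unions of children, up to the
    complement of [Q], and [f] is dominated by a multiple of [\1_Q]. *)
Lemma sqint_step j Q f : D j Q -> step_functions D j Q f -> sqint mu f.
Proof.
move=> jQ [f0 fc].
have mQ : measurable Q := dyadic_measurable dyD jQ.
have finC := finite_children dyD jQ.
have mf : measurable_fun setT f.
  move=> _ Y mY; rewrite setTI.
  rewrite (_ : _ @^-1` _ = \bigcup_(Q' in [set Q' | children D j Q Q' /\
      exists2 x, Q' x & Y (f x)]) Q' `|` (~` Q `&` [set x | Y 0])).
    apply: measurableU.
      apply: fin_bigcup_measurable.
        by apply: sub_finite_set finC => Q' [].
      by move=> Q' [[jQ' _] _]; exact: (dyadic_measurable dyD jQ').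
    apply: measurableI; first exact: measurableC.
    have [Y0|Y0] := pselect (Y 0).
      by rewrite (_ : [set _ | _] = setT)//; apply/seteqP; split.
    by rewrite (_ : [set _ | _] = set0)//; apply/seteqP; split.
  apply/seteqP; split=> [x /= Yfx|x [[Q' [cQ' [y Q'y Yy]] Q'x]|[nQx Y0]]].
  - have [Qx|nQx] := pselect (Q x); last first.
      by right; split=> //=; rewrite -(f0 _ nQx).
    have [Q' cQ' Q'x] := children_cover dyD jQ Qx.
    by left; exists Q' => //; split=> //; exists x.
  - by have [c Hc] := fc _ cQ'; rewrite /= Hc// -(Hc y).
  - by rewrite /= f0.
have [M HM] : exists M : R, forall x, `|f x| <= M.
  have /choice[c Hc] : forall Q', exists c, children D j Q Q' ->
      forall x, Q' x -> f x = c.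
    move=> Q'; have [/fc[c Hc]|nc] := pselect (children D j Q Q').
      by exists c.
    by exists 0.
  have : bounded_set ((c @` children D j Q) `|` [set 0] : set R).
    apply: compact_bounded; apply: finite_compact.
    by rewrite finite_setU; split; [exact: finite_image|exact: finite_set1].
  move=> [M [_ HM]]; exists (M + 1) => x; apply: HM; first by rewrite ltrDl.
  have [Qx|nQx] := pselect (Q x); last by right; rewrite f0.
  have [Q' cQ' Q'x] := children_cover dyD jQ Qx.
  by left; exists Q' => //; rewrite (Hc _ cQ' _ Q'x).
apply: (@sqint_le _ _ _ _ _ (M *: (\1_Q : X -> R))) => //.
  by apply: sqintZ; exact: sqint_cube jQ.
move=> x; rewrite [X in _ <= X ^+ 2](_ : _ = M * \1_Q x)// indicE.
have [/set_mem Qx|/negbTE nQx] := boolP (x \in Q).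
  rewrite mulr1 -[leLHS]real_normK ?num_real// -[leRHS]real_normK ?num_real//.
  by rewrite ler_pXn2r ?nnegrE//; apply: (le_trans (HM x)); exact: ler_norm.
rewrite f0 ?mulr0// => Qx; by rewrite mem_set in nQx.
Qed.

(** Expand [\1_Q'] in the orthonormal basis attached to [Q]. As [mu Q] exceeds [lambda], [v] is
    orthogonal to the Haar functions of [Q], so only the normalised indicator of [Q] contributes to
    [dot mu \1_Q' v]. *)
Lemma child_avg (lambda : R) j Q Q' v : D j Q -> (lambda%:E < mu Q)%E ->
  children D j Q Q' -> ker_Pi mu D h lambda v -> avg mu Q' v = avg mu Q v.
Proof.
move=> jQ lQ cQ' [/Lfun2P sv [_ vorth]].
have [M HM] := dyadic_children dyD.
have [n [/andP[n1 _] cn]] := HM _ _ jQ.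
(* An only child covers its parent, so then [Q' = Q]. *)
have [n1'|n1'] := ltnP 1 n; last first.
  suff -> : Q' = Q by [].
  apply/seteqP; split; first by case: cQ'.
  move=> x Qx; have [Q1 cQ1 Q1x] := children_cover dyD jQ Qx.
  have nE : n = 1%N by apply/eqP; rewrite eqn_leq n1 n1'.
  move: cn; rewrite nE => /eq_cardSP[Q2 _].
  rewrite II0 card_eq0 => /eqP/seteqP[HC _].
  have only P : children D j Q P -> P = Q2.
    by move=> cP; apply: contrapT => PQ2; exact: (HC P).
  by rewrite (only _ cQ') -(only _ cQ1).
pose e := fun i : 'I_n => if (i : nat) is l.+1 then h Q l
  else fun x : X => (Num.sqrt (fine (mu Q)))^-1 * \1_Q x.
have [e_in e_orth e_span] : orthonormal_basis mu e (step_functions D j Q) :=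
  haarD jQ cn n1'.
have {}e_orth i k : dot mu (e i) (e k) = (i == k)%:R := e_orth i k.
have se i : sqint mu (e i) by exact: sqint_step (e_in i).
have jQ' : D (j + 1) Q' by case: cQ'.
have sQ' := sqint_cube jQ'; have sQ := sqint_cube jQ.
have n0 : (0 < n)%N by exact: n1.
pose i0 : 'I_n := Ordinal n0.
have e0E : e i0 = (Num.sqrt (fine (mu Q)))^-1 *: (\1_Q : X -> R).
  by apply/funext => x; rewrite /e /=.
have /andP[Q0 Qoo] := cube_fin jQ; have /andP[Q'0 Q'oo] := cube_fin jQ'.
have q0 : 0 < fine (mu Q) by rewrite fine_gt0// Q0.
have q'0 : 0 < fine (mu Q') by rewrite fine_gt0// Q'0.
have [|c cE] := e_span (\1_Q' : X -> R).
  split=> [x nQx|P [jP _]].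
    rewrite indicE; case: (boolP (x \in Q')) => // /set_mem Q'x.
    by exfalso; apply: nQx; case: cQ' => _; exact.
  have [->|PQ'] := pselect (P = Q').
    by exists 1 => x Q'x; rewrite indicE mem_set.
  exists 0 => x Px; rewrite indicE; case: (boolP (x \in Q')) => // /set_mem Q'x.
  by exfalso; apply: PQ'; exact: (cube_uniq dyD jP jQ' Px Q'x).
have indE : (\1_Q' : X -> R) = \sum_(i < n) c i *: e i.
  by apply/funext => x; rewrite cE fct_sumE.
have vh l : (l.+1 < n)%N -> dot mu (h Q l) v = 0.
  move=> ln.
  have hl : sqint mu (h Q l) by exact: (se (Ordinal ln)).
  rewrite dotC -(vorth (h Q l)).
    by apply: eq_Rintegral => x _ /=; rewrite subr0.
  split; first exact/Lfun2P.
  move=> eps eps0; exists (h Q l).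
    exists 1%N, (fun=> 1), (fun=> h Q l); split=> [i|].
      by exists j, Q, n, l; split=> //; rewrite -ltnS prednK.
    by apply/funext => x; rewrite big_ord1 mul1r.
  rewrite (_ : EFin \o _ = cst 0%E).
    by rewrite Lnorm0 ?lte_fin// eqe.
  by apply/funext => x /=; rewrite subrr.
(* The coefficient is read off by pairing the expansion with [e i0]; the product of the two
   indicators is [\1_Q']. *)
have c0E : c i0 = fine (mu Q') / Num.sqrt (fine (mu Q)).
  have [_] := sqint_dot_sum (index_enum 'I_n) c (se i0) se.
  rewrite -indE (bigD1 i0)//= big1 ?addr0; last first.
    by move=> i ii0; rewrite e_orth (negbTE ii0) mulr0.
  rewrite e_orth eqxx mulr1 => <-.
  rewrite e0E dotC dotZl// mulrC; congr (_ * _).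
  rewrite (_ : dot mu \1_Q \1_Q' = dot mu \1_Q' \1_Q').
    by rewrite dot_indic//; exact: (dyadic_measurable dyD jQ').
  apply: eq_Rintegral => x _; rewrite !indicE.
  have [/set_mem Q'x|_] := boolP (x \in Q'); last by rewrite !mulr0.
  by rewrite mem_set//; case: cQ' => _; exact.
have dv : dot mu \1_Q' v = c i0 * dot mu (e i0) v.
  have [_] := sqint_dot_sum (index_enum 'I_n) c sv se.
  rewrite -indE => ->; rewrite (bigD1 i0)//= big1 ?addr0// => -[[|l] ln] ii0.
    by exfalso; move: ii0; rewrite -val_eqE.
  by rewrite /e /= vh// mulr0.
rewrite /avg (dotC _ v \1_Q') dv e0E dotZl// c0E (dotC _ \1_Q).
have sq0 : Num.sqrt (fine (mu Q)) != 0 by rewrite gt_eqF// sqrtr_gt0.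
have sqE : fine (mu Q) = Num.sqrt (fine (mu Q)) ^+ 2 by rewrite sqr_sqrtr// ltW.
rewrite [in RHS]sqE; field.
by rewrite sq0 gt_eqF.
Qed.

(** The generation depends on [lambda] only: from [- n0] upwards all ancestors are larger than
    [lambda], so [child_avg] carries the average along the whole chain, where [avg_sqr_le] makes it
    tend to 0. *)
Lemma ker_Pi_zero_mean (lambda : R) : exists j, forall v Q,
  ker_Pi mu D h lambda v -> D j Q -> avg mu Q v = 0.
Proof.
have [n0 Hn0] := cube_large lambda; exists (- n0%:Z) => v Q kv nQ.
have anc k : exists2 A, D (- (n0 + k)%:Z) A & avg mu Q v = avg mu A v.
  elim: k => [|k [A kA QA]]; first by exists Q => //; rewrite addn0.
  have kE : - (n0 + k)%:Z = - (n0 + k.+1)%:Z + 1 by rewrite addnS; lia.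
  rewrite kE in kA; have [B [[kB AB] _]] := dyadic_parent dyD kA.
  exists B => //; rewrite QA; apply: (child_avg kB _ _ kv) => //.
  have /andP[_ Boo] := cube_fin kB.
  rewrite -(@fineK _ (mu B)) ?ge0_fin_numE// lte_fin.
  by apply: (Hn0 _ _ _ kB); rewrite leq_addr.
have [/Lfun2P sv _] := kv.
apply: (@sqr_le_small_eq0 _ _ (dot mu v v)) => e e0.
(* An ancestor of measure above [e^-1] makes the bound of [avg_sqr_le] at most [dot mu v v * e]. *)
have [n1 Hn1] := cube_large e^-1.
have [A nA ->] := anc n1.
apply: (le_trans (avg_sqr_le sv (dyadic_measurable dyD nA) (cube_fin nA))).
rewrite ler_wpM2l ?dot_ge0// -[leRHS]invrK lef_pV2 ?posrE ?invr_gt0//.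
  by apply/ltW/(Hn1 _ _ _ nA); rewrite leq_addl.
by have /andP[A0 Aoo] := cube_fin nA; rewrite fine_gt0// A0.
Qed.

Lemma ker_P_zero_mean j v Q : ker_P mu D j v -> D j Q -> avg mu Q v = 0.
Proof.
move=> [/Lfun2P sv [_ vorth]] jQ.
rewrite /avg (_ : dot mu v \1_Q = 0) ?mul0r// -(vorth \1_Q).
  by apply: eq_Rintegral => x _ /=; rewrite subr0.
split; first exact/Lfun2P/sqint_cube/jQ.
move=> P jP; have [->|PQ] := pselect (P = Q).
  by exists 1; apply/nearW => x Qx; rewrite indicE mem_set.
exists 0; apply/nearW => x Px; rewrite indicE.
case: (boolP (x \in Q)) => // /set_mem Qx.
by exfalso; apply: PQ; exact: (cube_uniq dyD jP jQ Px Qx).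
Qed.

End zero_mean.

(** * The reproducing kernel *)

Section reproducing_kernel.
Context {R : realType} {d : measure_display} {X : metricMeasurableType d R}.
Variable mu : {sigma_finite_measure set X -> \bar R}.
Variables gamma s : R.
Hypothesis borelX : is_borel X.
Hypothesis gamma_gt0 : 0 < gamma.
Hypothesis s_gt : gamma / 2 < s.
Hypothesis mdist_measurable :
  measurable_fun setT (fun z : X * X => mdist z.1 z.2).
Variables c1 c2 : R.
Hypothesis c1_gt0 : 0 < c1.
Hypothesis muball : forall (x : X) (r : R), 0 < r ->
  ((c1 * r `^ gamma)%:E <= mu (ball x r) <= (c2 * r `^ gamma)%:E)%E.

Local Notation gquot := (gquot gamma s).
Local Notation gform := (gform mu gamma s).

(** If [f] and [g] differ at [x], they differ on a ball around [x], which has positive measure. *)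
Lemma continuous_ae_eq (f g : X -> R) : continuous f -> continuous g ->
  f = g %[ae mu] -> f =1 g.
Proof.
move=> cf cg [N [mN N0 fgN]] x; apply: contrapT => fgx.
pose h y := `|f y - g y|.
have ch : continuous h.
  by move=> y; apply: cvg_norm; apply: cvgB; [exact: cf|exact: cg].
have hx : 0 < h x by rewrite normr_gt0 subr_eq0; apply/eqP.
have : \forall y \near x, 0 < h y by exact: (cvgr_gt _ (ch x)).
move=> /nbhs_ballP[r /= r0 hr].
have : (mu (ball x r) <= mu N)%E.
  apply: le_measure; rewrite ?inE//; first exact: measurable_metric_ball.
  move=> y /hr hy; apply: fgN => /= /(_ I) fgy.
  by move: hy; rewrite /h fgy subrr normr0 ltxx.
have /andP[+ _] := mu_ball_fin c1_gt0 muball x r0.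
by move=> /lt_le_trans/[apply]; rewrite N0 ltxx.
Qed.

(** The quotients agree off [N * X] and [X * N], both null for the product measure when [N] is
    null. *)
Lemma gquot_ae (f g : X -> R) : f = g %[ae mu] ->
  gquot f = gquot g %[ae (mu \x mu)%E].
Proof.
move=> [N [mN N0 fgN]].
exists ((N `*` setT) `|` (setT `*` N)); split.
- by apply: measurableU; exact: measurableX.
- apply/eqP; rewrite eq_le measure_ge0 andbT.
  apply: (@le_trans _ _ ((mu \x mu) (N `*` setT) + (mu \x mu) (setT `*` N))%E).
    by apply: measureU2; exact: measurableX.
  have NE : mu N = 0%E by [].
  have E1 : ((mu \x mu) (N `*` setT) = mu N * mu setT)%E.
    exact: product_measure1E.
  have E2 : ((mu \x mu) (setT `*` N) = mu setT * mu N)%E.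
    exact: product_measure1E.
  by rewrite E1 E2 NE mul0e mule0 adde0.
- move=> [y x] /= /not_implyP[_ nfg]; apply: contrapT => /not_orP[n1 n2].
  have fgy : f y = g y.
    by apply: contrapT => fgy; apply: n1; split=> //; apply: fgN => /(_ I).
  have fgx : f x = g x.
    by apply: contrapT => fgx; apply: n2; split=> //; apply: fgN => /(_ I).
  by apply: nfg; rewrite /gquot /= fgx fgy.
Qed.

Section closed_subspace.
Variable V : set (X -> R).
Hypothesis V_sqint : forall u, V u -> sqint mu u.

(** The space [H0] expressed through [sqint] and orthogonality, with [V] standing for the range of
    either projection. *)
Definition orth_sobolev (v : X -> R) : Prop :=
  [/\ sqint mu v, sqint (mu \x mu)%E (gquot v) &
      forall u, V u -> dot mu v u = 0].

Lemma orth_sobolev0 : orth_sobolev 0.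
Proof.
have q0 : gquot (0 : X -> R) = (0 : X * X -> R).
  by apply/funext => z; rewrite /gquot /= subrr mul0r.
split; rewrite ?q0; try exact: sqint0.
move=> u /V_sqint su; have := dotZl 0 su su.
by rewrite scale0r mul0r.
Qed.

Lemma orth_sobolevD u v : orth_sobolev u -> orth_sobolev v ->
  orth_sobolev (u + v).
Proof.
move=> [u1 u2 u3] [v1 v2 v3]; split; first exact: sqintD.
  by rewrite gquotD; exact: sqintD.
by move=> w Vw; rewrite dotDl ?u3 ?v3 ?addr0//; exact: V_sqint.
Qed.

Lemma orth_sobolevZ (a : R) u : orth_sobolev u -> orth_sobolev (a *: u).
Proof.
move=> [u1 u2 u3]; split; first exact: sqintZ.
  by rewrite gquotZ; exact: sqintZ.
by move=> w Vw; rewrite dotZl ?u3 ?mulr0//; exact: V_sqint.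
Qed.

Lemma orth_sobolevB u v : orth_sobolev u -> orth_sobolev v ->
  orth_sobolev (u - v).
Proof.
move=> hu hv; apply: orth_sobolevD => //; rewrite -scaleN1r.
exact: orth_sobolevZ.
Qed.

Lemma orth_sobolev_ae u v : measurable_fun setT v -> u = v %[ae mu] ->
  orth_sobolev u -> orth_sobolev v.
Proof.
move=> mv uv [u1 u2 u3]; have [um _] := u1.
split; first exact: sqint_ae uv u1.
- apply: (sqint_ae _ (gquot_ae uv) u2).
  exact: measurable_gquot.
- move=> w Vw; rewrite -(u3 w Vw); apply: dot_ae => //.
  + by move: uv; apply: filterS => x H I; rewrite H.
  + by have [] := V_sqint Vw.
Qed.

Variables rho a : R.
Hypothesis rho_ge0 : 0 <= rho.
Hypothesis a_gt0 : 0 < a.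
Hypothesis zero_mean : forall v, orth_sobolev v -> forall x,
  exists A, [/\ measurable A, (0 < mu A < +oo)%E, a <= fine (mu A),
     near_set rho x A & avg mu A v = 0].

Let crep v : orth_sobolev v -> exists2 w, continuous w & v = w %[ae mu].
Proof.
move=> [sv sg _]; exists (rep mu v).
- exact: (rep_continuous borelX gamma_gt0 s_gt mdist_measurable c1_gt0 muball sv
    sg).
- exact: (rep_ae borelX gamma_gt0 s_gt mdist_measurable c1_gt0 muball sv
    sg).
Qed.

Let sup_bound : exists2 C, 0 <= C & forall v x, orth_sobolev v -> continuous v ->
  v x ^+ 2 <= C * gform v v.
Proof.
set C := 2 * holder_cst gamma s c1 / (1 - 2^-1 `^ (s - gamma / 2)) ^+ 2 +
  2 * (1 + rho) `^ (gamma + 2 * s) / (c1 * a).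
have C0 : 0 <= C.
  apply: addr_ge0.
    by apply: divr_ge0; rewrite ?sqr_ge0// mulr_ge0// holder_cst_ge0.
  by apply: divr_ge0; rewrite mulr_ge0 ?powR_ge0// ltW.
exists C => // v x hv cv; have [sv sg _] := hv.
have [A [mA A0 Aa nA avg0]] := zero_mean hv x.
have vrep : v =1 rep mu v.
  apply: continuous_ae_eq => //.
  - exact: (rep_continuous borelX gamma_gt0 s_gt mdist_measurable c1_gt0 muball sv
    sg).
  - exact: (rep_ae borelX gamma_gt0 s_gt mdist_measurable c1_gt0 muball sv
    sg).
rewrite vrep.
exact: (rep_sqr_le borelX gamma_gt0 s_gt mdist_measurable c1_gt0 muball sv sg
  rho_ge0 a_gt0 mA A0 Aa nA avg0).
Qed.

Let l2_bound : exists2 C, 0 <= C & forall v, orth_sobolev v ->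
  dot mu v v <= C * gform v v.
Proof.
exists (rho `^ (gamma + 2 * s) / a); first by rewrite divr_ge0 ?powR_ge0// ltW.
move=> v hv; have [sv sg _] := hv.
exact: (poincare gamma_gt0 s_gt mdist_measurable sv sg a_gt0 (zero_mean hv)).
Qed.

(* The sup-norm bound makes an energy-Cauchy sequence converge pointwise, so
   that completeness follows from Fatou's lemma alone. *)
Lemma orth_sobolev_complete (v : nat -> X -> R) :
  (forall n, orth_sobolev (v n) /\ continuous (v n)) ->
  (forall e : R, 0 < e -> exists N : nat, forall m n,
     (N <= m)%N -> (N <= n)%N ->
     gform (v m - v n) (v m - v n) <= e) ->
  exists2 g, orth_sobolev g /\ continuous g &
    forall e : R, 0 < e -> exists N : nat, forall n, (N <= n)%N ->
     gform (v n - g) (v n - g) <= e.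
Proof.
move=> hv cauchy.
have [C C0 supC] := sup_bound; have [C' C'0 l2C] := l2_bound.
have ov n : orth_sobolev (v n) by case: (hv n).
have mv n : measurable_fun setT (v n) by case: (ov n) => -[].
have vcvg x : (fun n => v n x) @ \oo --> lim ((fun n => v n x) @ \oo).
  apply/cauchy_cvgP/cauchy_exP => e e0.
  (* Adding 1 keeps the denominator positive when [C = 0]; half of [e] leaves room for the strict
     inequality. *)
  have e'0 : 0 < (e / 2) ^+ 2 / (C + 1).
    by rewrite divr_gt0 ?exprn_gt0 ?divr_gt0// ltr_wpDl.
  have [N HN] := cauchy _ e'0.
  exists (v N x); exists N => // n /= Nn; rewrite /ball /=.
  have oNn := orth_sobolevB (ov N) (ov n).
  have cNn : continuous (v N - v n).
    by move=> y; apply: cvgB; [exact: (hv N).2|exact: (hv n).2].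
  have H : (v N x - v n x) ^+ 2 <= (e / 2) ^+ 2.
    apply: (le_trans (supC _ x oNn cNn)).
    apply: (@le_trans _ _ ((C + 1) * ((e / 2) ^+ 2 / (C + 1)))).
      by apply: ler_pM; rewrite ?dot_ge0 ?HN// lerDl.
    by rewrite mulrC mulfVK// gt_eqF// ltr_wpDl.
  apply: (@le_lt_trans _ _ (e / 2)); last by lra.
  rewrite -(@ler_pXn2r _ 2) ?nnegrE ?divr_ge0 ?(ltW e0)//.
  by rewrite real_normK ?num_real.
pose g x := lim ((fun n => v n x) @ \oo).
have mg : measurable_fun setT g.
  by apply: (measurable_fun_cvg (h := v)) => // x _; exact: vcvg.
have vgcvg n x : (fun m => v n x - v m x) @ \oo --> v n x - g x.
  by apply: cvgB; [exact: cvg_cst|exact: vcvg].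
have sqr_cvg (f : nat -> R) (l : R) : f @ \oo --> l ->
    (fun n => f n ^+ 2) @ \oo --> l ^+ 2.
  by move=> fl; rewrite expr2; under eq_fun do rewrite expr2; exact: cvgM.
(* Fatou is applied in [m] to [v n - v m] with [n] fixed. *)
have limE (e : R) : 0 < e -> exists N : nat, forall n, (N <= n)%N ->
    (\int[mu]_x ((v n - g) x ^+ 2)%:E <= (C' * e)%:E)%E /\
    (\int[mu \x mu]_z (gquot (v n - g) z ^+ 2)%:E <= e%:E)%E.
  move=> e0; have [N HN] := cauchy _ e0; exists N => n Nn; split.
  - apply: (@fatou_bounded _ _ _ _ (fun m x => (v n - v m) x ^+ 2) _ _ N).
    + by move=> m; apply: measurable_funX; exact: measurable_funB.
    + by move=> m x; exact: sqr_ge0.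
    + by move=> x; apply: sqr_cvg; exact: vgcvg.
    + move=> m Nm; have om := orth_sobolevB (ov n) (ov m).
      have [sm _ _] := om; rewrite -EFin_dot// lee_fin.
      by apply: (le_trans (l2C _ om)); rewrite ler_wpM2l// HN.
  - apply: (@fatou_bounded _ _ _ _ (fun m z => gquot (v n - v m) z ^+ 2) _ _ N).
    + move=> m; apply: measurable_funX; apply: measurable_gquot => //.
      exact: measurable_funB.
    + by move=> m x; exact: sqr_ge0.
    + move=> z; apply: sqr_cvg; rewrite /gquot /=.
      apply: cvgM; last exact: cvg_cst.
      by apply: cvgB; exact: vgcvg.
    + move=> m Nm; have [_ sm _] := orth_sobolevB (ov n) (ov m).
      by rewrite -EFin_dot// lee_fin; exact: HN.
have sB (e : R) : 0 < e -> exists N : nat, forall n, (N <= n)%N ->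
    [/\ sqint mu (v n - g), sqint (mu \x mu)%E (gquot (v n - g)),
        dot mu (v n - g) (v n - g) <= C' * e & gform (v n - g) (v n - g) <= e].
  move=> /limE[N HN]; exists N => n /HN[H1 H2].
  have mB : measurable_fun setT (v n - g) by exact: measurable_funB.
  have s1 : sqint mu (v n - g).
    by split=> //; apply: le_lt_trans H1 _; rewrite ltry.
  have s2 : sqint (mu \x mu)%E (gquot (v n - g)).
    split; first exact: measurable_gquot.
    by apply: le_lt_trans H2 _; rewrite ltry.
  by split=> //; rewrite -lee_fin EFin_dot.
have og : orth_sobolev g.
  have [N /(_ N (leqnn _))[s1 s2 _ _]] := sB 1 ltr01.
  have gE : g = v N - (v N - g) by rewrite subKr.
  have [u1 u2 u3] := ov N.
  have sg : sqint mu g by rewrite gE; exact: sqintB.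
  split=> //.
    rewrite gE -scaleN1r gquotD gquotZ; apply: sqintD => //; exact: sqintZ.
  move=> u Vu; have su := V_sqint Vu.
  (* Orthogonality passes to the limit: [dot mu g u] equals [- dot mu (v n - g) u], which is small
     by Cauchy-Schwarz. *)
  apply: (@sqr_le_small_eq0 _ _ (dot mu u u * C')) => e e0.
  have [n /(_ n (leqnn _))[t1 t2 t3 _]] := sB e e0.
  have [w1 _ w3] := ov n.
  have -> : dot mu g u = - dot mu (v n - g) u.
    rewrite -(scaleN1r g) dotDl ?dotZl ?w3 ?add0r ?mulN1r ?opprK//.
    exact: sqintZ.
  rewrite sqrrN; apply: (le_trans (dot_cauchy_schwarz t1 su)).
  by rewrite -mulrA ler_wpM2l ?dot_ge0.
(* The pointwise limit is exchanged for its continuous representative; the quotients change only on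
   a null set, so the form keeps its value. *)
have [w cw gw] := crep og.
have mw : measurable_fun setT w by exact: measurable_continuous.
exists w; first by split=> //; exact: orth_sobolev_ae gw og.
move=> e /sB[N HN]; exists N => n /HN[s1 s2 _ H]; apply: le_trans H.
have vgw : v n - g = v n - w %[ae mu].
  move: gw; apply: filterS => x /(_ I) gwx _.
  by rewrite [LHS](_ : _ = v n x - g x)// gwx.
have mvw : measurable_fun setT (v n - w) by exact: measurable_funB.
have mqw := measurable_gquot gamma s mdist_measurable mvw.
have [mqg _] := s2.
have qae := gquot_ae vgw.
rewrite le_eqVlt /gform; apply/orP; left; apply/eqP.
rewrite (dot_ae qae)// dotC (dot_ae qae)//.
Qed.

(** Riesz is applied to the continuous members, where evaluation at [x] is linear and bounded by
    [sup_bound]. Any other [v] is replaced by its continuous representative, which leaves the form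
    unchanged. *)
Lemma reproducing_function (x : X) :
  exists2 g, orth_sobolev g /\ continuous g &
    forall v, orth_sobolev v -> exists2 w, continuous_representative mu v w &
      bilinear_form mu gamma s g v = (w x)%:E.
Proof.
have [C C0 supC] := sup_bound.
have [g [og cg] gP] : exists2 g, orth_sobolev g /\ continuous g &
    forall v, orth_sobolev v /\ continuous v -> gform g v = v x.
  apply: (@riesz_representation R (X -> R) _ gform _ _ _ _ _ _ _ _
    (fun v => v x) C) => //.
  - by split; [exact: orth_sobolev0|move=> y; exact: cvg_cst].
  - move=> u v [ou cu] [ov cv]; split; first exact: orth_sobolevD.
    by move=> y; apply: cvgD; [exact: cu|exact: cv].
  - move=> t u [ou cu]; split; first exact: orth_sobolevZ.
    by move=> y; apply: cvgM; [exact: cvg_cst|exact: cu].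
  - by move=> u v _ _; exact: dotC.
  - move=> u v w [[_ su _] _] [[_ sv _] _] [[_ sw _] _].
    by rewrite /gform gquotD dotDl.
  - by move=> t u w [[_ su _] _] [[_ sw _] _]; rewrite /gform gquotZ dotZl.
  - by move=> u _; exact: dot_ge0.
  - exact: orth_sobolev_complete.
  - by move=> u [ou cu]; exact: supC.
exists g => // v ov; have [w cw vw] := crep ov; exists w => //.
have ow : orth_sobolev w.
  by apply: orth_sobolev_ae vw ov; exact: measurable_continuous.
have [_ sg _] := og; have [[mv _] [mqv sqv] _] := ov; have [_ [mqw _] _] := ow.
rewrite bilinear_formE//; congr EFin; rewrite -(gP w)//.
rewrite /gform dotC (dot_ae (gquot_ae vw))//; first by rewrite dotC.
by have [] := sg.
Qed.

End closed_subspace.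
End reproducing_kernel.

(** * Sigma-finiteness of the measure *)

Section sigma_finite_packing.
Context {d : measure_display} {T : measurableType d} {R : realType}.
Variable mu : {measure set T -> \bar R}.
Hypothesis sf : sigma_finite setT mu.

Let nu : set T -> \bar R := mu.

HB.instance Definition _ := Measure.on nu.
HB.instance Definition _ := Measure_isSigmaFinite.Build _ _ _ nu sf.

(** The product measure and Tonelli's theorem call for the sigma-finite structure; an equality of
    measures lets the given [mu] be replaced by [m]. *)
Lemma sigma_finite_measure_ex :
  exists m : {sigma_finite_measure set T -> \bar R},
    m = mu :> {measure set T -> \bar R}.
Proof. by exists nu; exact: eq_measure. Qed.

End sigma_finite_packing.

Lemma ahlfors_sigma_finite {R : realType} {d : measure_display}
    {X : metricMeasurableType d R} (mu : {measure set X -> \bar R}) (gamma : R) :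
  is_borel X -> ahlfors_regular mu gamma -> sigma_finite setT mu.
Proof.
move=> borelX [c1 [c2 [c10 c20 muball]]].
exists (fun n => ball (point : X) n.+1%:R).
  apply/seteqP; split=> // x _.
  exists (Num.trunc (mdist (point : X) x)) => //.
  by rewrite ballEmdist /= truncnS_gt.
move=> n; split; first exact: measurable_metric_ball.
have n0 : 0 < n.+1%:R :> R by [].
have /andP[_ +] := muball point _ n0.
by move=> /le_lt_trans; apply; rewrite ltry.
Qed.

(** * Both kernels at once, and the final result *)

Section main.
Context {R : realType} {d : measure_display} {X : metricMeasurableType d R}.
Variable mu : {sigma_finite_measure set X -> \bar R}.
Variables (gamma s : R) (D : int -> set (set X)).
Hypothesis borelX : is_borel X.
Hypothesis gamma_gt0 : 0 < gamma.
Hypothesis regular : ahlfors_regular mu gamma.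
Hypothesis dyD : dyadic_family D.
Hypothesis s_gt : gamma / 2 < s.

(** The two kinds of [H0] share this form: all that enters is the vanishing of averages over the
    cubes of one generation [j]. *)
Lemma green_function_ker (V : set (X -> R)) j :
  V (fun=> 0) -> V `<=` L2 mu ->
  (forall v Q, ker_projection mu V v -> D j Q -> avg mu Q v = 0) ->
  exists G : X -> X -> R, forall x : X,
    [/\ (sobolev mu (s / gamma) `&` ker_projection mu V) (G x),
        continuous (G x) &
        forall v : X -> R, (sobolev mu (s / gamma) `&` ker_projection mu V) v ->
          exists2 w : X -> R, continuous_representative mu v w &
            bilinear_form mu gamma s (G x) v = (w x)%:E].
Proof.
move=> V0 VL2 Vmean.
have [c1 [c2 [c10 c20 muball]]] := regular.
have [p p_dense] := dense_sequence dyD.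
have mdistm := measurable_mdist borelX p_dense.
have V_sqint u : V u -> sqint mu u by move=> /VL2/Lfun2P.
have kerE v : ker_projection mu V v <->
    sqint mu v /\ forall u, V u -> dot mu v u = 0.
  have subE u : L2dot mu (v \- (fun=> 0)) u = dot mu v u.
    by apply: eq_Rintegral => x _ /=; rewrite subr0.
  split=> [[/Lfun2P sv [_ vV]]|[sv vV]].
    by split=> // u /vV; rewrite subE.
  by split; [exact/Lfun2P|split=> // u Vu; rewrite subE vV].
have HE v : (sobolev mu (s / gamma) `&` ker_projection mu V) v <->
    orth_sobolev mu gamma s V v.
  split=> [[/(sobolevP gamma_gt0 s_gt mdistm regular)[sv sg] /kerE[_ vV]]|].
    by split.
  move=> [sv sg vV]; split; last exact/kerE.
  exact/(sobolevP gamma_gt0 s_gt mdistm regular).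
have [nu [b [c [/andP[nu0 _] b0 c0 Qsize]]]] :=
  cube_size gamma_gt0 borelX dyD c10 muball.
have nuj : 0 < nu ^ j by rewrite exprz_gt0.
(* The set is the cube of generation [j] through [x]; its size bounds depend on neither [v] nor [x],
   so the resulting estimates are uniform. *)
have zero_mean v : orth_sobolev mu gamma s V v -> forall x, exists A,
    [/\ measurable A, (0 < mu A < +oo)%E, b * (nu ^ j) `^ gamma <= fine (mu A),
        near_set (c * nu ^ j) x A & avg mu A v = 0].
  move=> /HE[_ kv] x; have [Q jQ Qx] := cube_at dyD j x.
  have [Q0 Qb Qc] := Qsize _ _ jQ.
  exists Q; split=> //; first exact: (dyadic_measurable dyD jQ).
    by move=> y Qy; exact: Qc.
  exact: Vmean kv jQ.
have rho0 : 0 <= c * nu ^ j by rewrite mulr_ge0// ltW.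
have a0 : 0 < b * (nu ^ j) `^ gamma by rewrite mulr_gt0// powR_gt0.
have /choice[G GP] : forall x, exists g, (orth_sobolev mu gamma s V g /\
    continuous g) /\ forall v, orth_sobolev mu gamma s V v ->
    exists2 w, continuous_representative mu v w &
      bilinear_form mu gamma s g v = (w x)%:E.
  move=> x; have [g og gP] := @reproducing_function _ _ _ mu _ _ borelX
    gamma_gt0 s_gt mdistm _ _ c10 muball _ V_sqint _ _ rho0 a0 zero_mean x.
  by exists g.
exists G => x; have [[oG cG] Gv] := GP x; split=> //; first exact/HE.
by move=> v /HE; exact: Gv.
Qed.

End main.

Theorem theorem10 (R : realType) (d : measure_display)
    (X : metricMeasurableType d R) (mu : {measure set X -> \bar R})
    (gamma s : R) (D : int -> set (set X)) (h : set X -> nat -> X -> R)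
    (H0 : set (X -> R)) :
  is_borel X ->
  0 < gamma ->
  ahlfors_regular mu gamma ->
  dyadic_family D ->
  haar_system mu D h ->
  gamma / 2 < s ->
  is_sobolev0 mu D h (s / gamma) H0 ->
  exists G : X -> X -> R, forall x : X,
    [/\ H0 (G x), continuous (G x) &
        forall v : X -> R, H0 v ->
          exists2 w : X -> R, continuous_representative mu v w &
            bilinear_form mu gamma s (G x) v = (w x)%:E].
Proof.
move=> borelX gamma_gt0 regular dyD haarD s_gt H0E.
have [nu nuE] := sigma_finite_measure_ex (ahlfors_sigma_finite borelX regular).
subst mu.
have [c1 [c2 [c10 _ muball]]] := regular.
have L20 : L2 nu (fun=> 0) by apply/Lfun2P; exact: sqint0.
case: H0E => [[lambda _ ->]|[j ->]].
- have [j jmean] :=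
    ker_Pi_zero_mean gamma_gt0 borelX dyD haarD c10 muball lambda.
  apply: (green_function_ker borelX gamma_gt0 regular dyD s_gt _ _ jmean).
  (* Zero is the empty linear combination. *)
  + split=> // e e0; exists (fun=> 0).
      exists 0%N, (fun=> 0), (fun=> fun=> 0); split=> [[]//|].
      by apply/funext => x; rewrite big_ord0.
    rewrite (_ : EFin \o _ = cst 0%E).
      by rewrite Lnorm0 ?lte_fin// eqe.
    by apply/funext => x /=; rewrite subrr.
  + by move=> u [].
- have jmean := ker_P_zero_mean gamma_gt0 borelX dyD c10 muball.
  apply: (green_function_ker borelX gamma_gt0 regular dyD s_gt _ _ (jmean j)).
  + by split=> // Q _; exists 0; exact: nearW.
  + by move=> u [].
Qed.
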